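(* Let $T>0$. Consider $C\in L^\infty(\mathbb{R};H_Q)$ such that the family of means $\left(\frac1S\int_{s_0}^{s_0+S}C(s)\,\mathrm{d}s\right)_{S>0}$ converges strongly in $H_Q$ toward some $\overline{C}\in H_Q$, uniformly with respect to $s_0\in\mathbb{R}$, when $S\to+\infty$. Let $\mathcal{B}_\omega\subset C([0,T];H_P)$ be a bounded set in $L^1([0,T];H_P)$ of functions which admit as modulus of continuity in $C([0,T];H_P)$ the same function $\omega:[0,T]\to\mathbb{R}_+$, i.e. $$|B(t)-B(t')|_P\le\omega(|t-t'|),\quad t,t'\in[0,T],\ B\in\mathcal{B}_\omega,$$ with $\omega$ non decreasing and $\lim_{\lambda\searrow0}\omega(\lambda)=0$. Then $$\lim_{\varepsilon\searrow0}\int_0^T\langle B(t),C(t/\varepsilon)\rangle_{P,Q}\,\mathrm{d}t=\int_0^T\langle B(t),\overline{C}\rangle_{P,Q}\,\mathrm{d}t$$ uniformly with respect to $B\in\mathcal{B}_\omega$.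
   Context: Standing setting: $m\ge1$; $b:\mathbb{R}^m\to\mathbb{R}^m$ with $b\in W^{1,\infty}_{\mathrm{loc}}$, $\mathrm{div}_y b=0$, $|b(y)|\le C(1+|y|)$ for some $C>0$; $P:\mathbb{R}^m\to\mathcal{M}_m(\mathbb{R})$ is a field of symmetric, positive definite matrices with $P,P^{-1}\in L^2_{\mathrm{loc}}(\mathbb{R}^m)$ and $(b\cdot\nabla_y)P-\partial_y b\,P-P\,{}^t\partial_y b=0$ in $\mathcal{D}'(\mathbb{R}^m)$; $Q=P^{-1}$. Notation: $M:N=\mathrm{tr}({}^tMN)$. $H_Q=\{A:\mathbb{R}^m\to\mathcal{M}_m(\mathbb{R})\text{ measurable}:\int QA:AQ\,\mathrm{d}y<\infty\}$ is a Hilbert space with scalar product $(A,B)_Q=\int QA:BQ\,\mathrm{d}y$ and norm $|A|_Q$; $H_P$ is defined likewise with $P$ in place of $Q$, with scalar product $(A,B)_P=\int PA:BP\,\mathrm{d}y$ and norm $|A|_P$. The duality $\langle\cdot,\cdot\rangle_{P,Q}:H_P\times H_Q\to\mathbb{R}$ is $\langle A,B\rangle_{P,Q}=\int_{\mathbb{R}^m}A(y):B(y)\,\mathrm{d}y$, which satisfies $|\langle A,B\rangle_{P,Q}|\le|A|_P|B|_Q$. *)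

(* Defs.v *)
From HB Require Import structures.
From mathcomp Require Import all_boot all_order all_algebra.
From mathcomp Require Import all_classical all_reals all_analysis.

Set Implicit Arguments.
Unset Strict Implicit.
Unset Printing Implicit Defensive.
Import Order.TTheory GRing.Theory Num.Theory.
Import numFieldNormedType.Exports.

Local Open Scope classical_set_scope.
Local Open Scope ring_scope.

(* The Borel sigma-algebra of 'M[R]_(m, n), generated by the entries. *)
Definition measure_mx_display : measure_display. Proof. exact. Qed.

Section measurable_matrix.
Context {R : realType} (m n : nat).

Definition mx_sigma_algebra : set (set 'M[R]_(m, n)) :=
  <<s \bigcup_(ij in [set: 'I_m * 'I_n])
        preimage_set_system setT (fun A : 'M[R]_(m, n) => A ij.1 ij.2)
          (@measurable _ (measurableTypeR R)) >>.

Let mx_set0 : mx_sigma_algebra set0.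
Proof. exact: sigma_algebra0. Qed.

Let mx_setC A : mx_sigma_algebra A -> mx_sigma_algebra (~` A).
Proof. exact: sigma_algebraC. Qed.

Let mx_bigcup (F : _^nat) : (forall i, mx_sigma_algebra (F i)) ->
  mx_sigma_algebra (\bigcup_i (F i)).
Proof. exact: sigma_algebra_bigcup. Qed.

HB.instance Definition _ := @isMeasurable.Build measure_mx_display
  'M[R]_(m, n) mx_sigma_algebra mx_set0 mx_setC mx_bigcup.

Lemma measurable_mx_entry i j :
  measurable_fun [set: 'M[R]_(m, n)] (fun A : 'M[R]_(m, n) => A i j).
Proof.
move=> _ Y mY; apply: sub_sigma_algebra; exists (i, j) => //=.
by exists Y.
Qed.

Lemma measurable_fun_mxP d (T : measurableType d) (f : T -> 'M[R]_(m, n)) :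
  measurable_fun [set: T] f <->
  forall i j, measurable_fun [set: T] (fun x => f x i j).
Proof.
split=> [mf i j|mf].
  exact: (measurableT_comp (measurable_mx_entry i j) mf).
suff : mx_sigma_algebra `<=` [set A | measurable (f @^-1` A)].
  by move=> mxf _ Y mY; rewrite setTI; exact: mxf.
apply: smallest_sub.
  split=> /=.
  - by rewrite preimage_set0.
  - by move=> A mA; rewrite setTD preimage_setC; exact: measurableC.
  - by move=> F mF; rewrite preimage_bigcup; exact: bigcup_measurable.
move=> _ [[i j] _ [Y mY <-]] /=; rewrite setTI.
by have := mf i j measurableT Y mY; rewrite setTI.
Qed.

End measurable_matrix.


Section lebesgue_rV.
Context {R : realType}.

Definition cons_row n (p : R * 'rV[R]_n) : 'rV[R]_n.+1 :=
  row_mx (const_mx p.1 : 'rV_1) p.2.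

Lemma measurable_cons_row n : measurable_fun setT (@cons_row n).
Proof.
apply/measurable_fun_mxP => i j; rewrite /cons_row.
case: (@splitP 1 n j) => k jk.
- rewrite (_ : (fun _ => _) = fst)//; apply/funext => p.
  by rewrite mxE; case: splitP => l; [rewrite mxE|rewrite jk => /eqP; rewrite ord1].
- rewrite (_ : (fun _ => _) = (fun v : 'rV[R]_n => v ord0 k) \o snd); last first.
    apply/funext => p; rewrite mxE; case: splitP => l; rewrite jk.
      by rewrite ord1.
    by move=> /eqP; rewrite eqn_add2l => /eqP/val_inj ->; rewrite (ord1 i).
  by apply: measurableT_comp => //; exact: measurable_mx_entry.
Qed.

Fixpoint lebesgue_rV (n : nat) : set 'rV[R]_n -> \bar R :=
  match n return set 'rV[R]_n -> \bar R with
  | 0 => \d_(0 : 'rV[R]_0)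
  | n'.+1 => pushforward (@lebesgue_measure R \x @lebesgue_rV n')%E
                         (@cons_row n')
  end.

Let uncons_row n (v : 'rV[R]_n.+1) : R * 'rV[R]_n :=
  (v ord0 ord0, \row_j v ord0 (lift ord0 j)).

Let uncons_rowK n : cancel (@cons_row n) (@uncons_row n).
Proof.
move=> [x v]; rewrite /uncons_row /cons_row /=; congr pair.
  by rewrite mxE; case: splitP => // l _; rewrite mxE.
apply/rowP => j; rewrite !mxE; case: splitP => l /=.
  by rewrite ord1.
by move=> /eqP; rewrite eqn_add2l => /eqP/val_inj ->.
Qed.

Let cons_rowK n : cancel (@uncons_row n) (@cons_row n).
Proof.
move=> v; apply/rowP => j; rewrite /cons_row /uncons_row mxE.
case: (@splitP 1 n j) => k jk; rewrite mxE.
  by congr (v _ _); apply/val_inj; rewrite /= jk ord1.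
by congr (v _ _); apply/val_inj; rewrite /= jk.
Qed.

Let measurable_uncons_row n : measurable_fun setT (@uncons_row n).
Proof.
apply: measurable_fun_pair; first exact: measurable_mx_entry.
apply/measurable_fun_mxP => i j.
under eq_fun do rewrite mxE.
exact: measurable_mx_entry.
Qed.

Lemma lebesgue_rV_measure n :
  exists mu : {sigma_finite_measure set 'rV[R]_n -> \bar R},
    (mu : set _ -> _) = @lebesgue_rV n.
Proof.
elim: n => [|n [mu mulam]].
  by exists (\d_(0 : 'rV[R]_0)).
pose pm : {measure set 'rV[R]_n.+1 -> \bar R} :=
  measure_function_pushforward__canonical__measure_function_Measure
    (@lebesgue_measure R \x mu)%E (@measurable_cons_row n).
have pmE : pm = @lebesgue_rV n.+1 :> (set _ -> _) by rewrite /= -mulam.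
have pmS : sigma_finite setT pm.
  have /sigma_finiteP[F [TF ndF Foo]] := sigma_finiteT (@lebesgue_measure R).
  have /sigma_finiteP[G [TG ndG Goo]] := sigma_finiteT mu.
  exists (fun k => @uncons_row n @^-1` (F k `*` G k)).
    apply/esym; rewrite -subTset => v _.
    have [k _ Fk] : (\bigcup_k F k) (v ord0 ord0) by rewrite -TF.
    have [l _ Gl] : (\bigcup_k G k) (\row_j v ord0 (lift ord0 j)) by rewrite -TG.
    exists (maxn k l) => //; split => /=.
    - by move: Fk; exact/subsetPset/ndF/leq_maxl.
    - by move: Gl; exact/subsetPset/ndG/leq_maxr.
  move=> k; have [mF Fk] := Foo k; have [mG Gk] := Goo k; split.
    rewrite -[X in measurable X]setTI; apply: measurable_uncons_row => //.
    exact: measurableX.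
  rewrite /= /pushforward -comp_preimage.
  rewrite (_ : @uncons_row n \o @cons_row n = id); last exact/funext/uncons_rowK.
  rewrite preimage_id product_measure1E//.
  by rewrite lte_mul_pinfty// ge0_fin_numE.
pose sm := Measure_isSigmaFinite.Build _ _ _ (pm : set _ -> \bar R) pmS.
pose nu : {sigma_finite_measure set 'rV[R]_n.+1 -> \bar R} :=
  HB.pack (pm : set _ -> \bar R) (Measure.class pm) sm.
by exists nu.
Qed.

Let lebesgue_rV0 n : @lebesgue_rV n set0 = 0%E.
Proof. by have [mu <-] := lebesgue_rV_measure n; exact: measure0. Qed.

Let lebesgue_rV_ge0 n A : (0 <= @lebesgue_rV n A)%E.
Proof. by have [mu <-] := lebesgue_rV_measure n; exact: measure_ge0. Qed.

Let lebesgue_rV_additive n : semi_sigma_additive (@lebesgue_rV n).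
Proof.
by have [mu <-] := lebesgue_rV_measure n; exact: measure_semi_sigma_additive.
Qed.

HB.instance Definition _ n := isMeasure.Build _ _ _ (@lebesgue_rV n)
  (@lebesgue_rV0 n) (@lebesgue_rV_ge0 n) (@lebesgue_rV_additive n).

Let lebesgue_rV_sigma_finite n : sigma_finite setT (@lebesgue_rV n).
Proof. by have [mu <-] := lebesgue_rV_measure n; exact: sigma_finiteT. Qed.

HB.instance Definition _ n := Measure_isSigmaFinite.Build _ _ _
  (@lebesgue_rV n) (@lebesgue_rV_sigma_finite n).

Lemma lebesgue_rV_box n (A : 'I_n -> set R) :
  (forall i, measurable (A i : set (measurableTypeR R))) ->
  lebesgue_rV [set v : 'rV[R]_n | forall i, A i (v ord0 i)] =
  (\prod_(i < n) @lebesgue_measure R (A i))%E.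
Proof.
elim: n A => [|n IH] A mA.
  rewrite big_ord0 /= (_ : [set _ | _] = setT) ?diracT//.
  by apply/seteqP; split => // v _ [].
rewrite big_ord_recl -IH//= /pushforward.
rewrite -product_measure1E//; last first.
  rewrite (_ : [set _ | _] =
      \bigcap_(i in setT) (fun v : 'rV[R]_n => v ord0 i) @^-1` A (lift ord0 i)).
    apply: fin_bigcap_measurable => // i _; rewrite -[X in measurable X]setTI.
    by apply: measurable_mx_entry => //; exact: mA.
  by apply/seteqP; split => v /= Av i => [_|]; exact: Av.
congr product_measure1; apply/seteqP; split => [[x v] /= Axv|[x v] /= [Ax Av] i].
- split.
    have := Axv ord0; rewrite /cons_row mxE; case: splitP => // l _.
    by rewrite mxE.
  move=> i; have := Axv (lift ord0 i); rewrite /cons_row mxE.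
  case: splitP => l; first by rewrite ord1.
  by move=> /eqP; rewrite eqn_add2l => /eqP/val_inj ->.
- rewrite /cons_row mxE; case: (@splitP 1 n i) => l il; rewrite ?mxE/=.
    by rewrite (_ : i = ord0)//; apply/val_inj; rewrite /= il ord1.
  by rewrite (_ : i = lift ord0 l)//; exact/val_inj.
Qed.

End lebesgue_rV.
Arguments lebesgue_rV {R n}.

Section distributions.
Context {R : realType} {m : nat}.
Implicit Types (phi u g : 'rV[R]_m -> R) (A : 'rV[R]_m -> 'M[R]_m).

Definition enorm (v : 'rV[R]_m) : R := Num.sqrt (\sum_(i < m) v ord0 i ^+ 2).

Definition partial (j : 'I_m) phi : 'rV[R]_m -> R := 'D_(delta_mx ord0 j) phi.

Fixpoint Ck (k : nat) phi : Prop :=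
  match k with
  | 0 => continuous phi
  | k'.+1 => continuous phi /\ forall j : 'I_m,
      (forall y, derivable phi y (delta_mx ord0 j)) /\ Ck k' (partial j phi)
  end.

Definition test_function phi : Prop :=
  (forall k, Ck k phi) /\ compact (closure [set y | phi y != 0]).

Definition Linfty_loc u : Prop :=
  measurable_fun setT u /\
  forall K : set 'rV[R]_m, compact K ->
    exists M : R, {ae lebesgue_rV, forall y, K y -> `|u y| <= M}.

Definition weak_partial (j : 'I_m) u g : Prop :=
  forall phi, test_function phi ->
    \int[lebesgue_rV]_y (u y * partial j phi y) =
    - \int[lebesgue_rV]_y (g y * phi y).

(* [b] is in W^{1,oo}_loc, with weak Jacobian (db y)_ij = d b_i / d y_j. *)
Definition W1infty_loc (b : 'rV[R]_m -> 'rV[R]_m) (db : 'rV[R]_m -> 'M[R]_m) :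
    Prop :=
  forall i : 'I_m, Linfty_loc (fun y => b y ord0 i) /\
    forall j : 'I_m, Linfty_loc (fun y => db y i j) /\
      weak_partial j (fun y => b y ord0 i) (fun y => db y i j).

Definition L2_loc A : Prop :=
  measurable_fun setT A /\
  forall (K : set 'rV[R]_m), compact K -> forall i j : 'I_m,
    (\int[lebesgue_rV]_(y in K) (A y i j ^+ 2)%:E < +oo)%E.

Definition spd (S : 'M[R]_m) : Prop :=
  S^T = S /\ forall xi : 'cV[R]_m, xi != 0 -> 0 < (xi^T *m S *m xi) ord0 ord0.

(* The distribution (b . grad) u = div (u b) - u div b tested against phi. *)
Definition transport_distr (b : 'rV[R]_m -> 'rV[R]_m) (db : 'rV[R]_m -> 'M[R]_m)
    u phi : R :=
  - \int[lebesgue_rV]_y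
      (u y * (\sum_(k < m) b y ord0 k * partial k phi y + \tr (db y) * phi y)).

(* (b . grad) P - db P - P db^T = 0 in D', entry by entry. *)
Definition transport_eq (b : 'rV[R]_m -> 'rV[R]_m)
    (db P : 'rV[R]_m -> 'M[R]_m) : Prop :=
  forall (i j : 'I_m) phi, test_function phi ->
    transport_distr b db (fun y => P y i j) phi
    - \int[lebesgue_rV]_y ((db y *m P y) i j * phi y)
    - \int[lebesgue_rV]_y ((P y *m (db y)^T) i j * phi y) = 0.

End distributions.

Section weighted_spaces.
Context {R : realType} {m : nat}.
Implicit Types W A B : 'rV[R]_m -> 'M[R]_m.

Definition frob (M N : 'M[R]_m) : R := \tr (M^T *m N).

(* Elements of H_W are handled through representatives: measurable fields A
   with int WA : AW < oo, A and B being the same element when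
   hnorm W (A - B) = 0. *)
Definition inH W A : Prop :=
  measurable_fun setT A /\
  (\int[lebesgue_rV]_y (frob (W y *m A y) (A y *m W y))%:E < +oo)%E.

Definition hdot W A B : R :=
  \int[lebesgue_rV]_y frob (W y *m A y) (B y *m W y).

Definition hnorm W A : R := Num.sqrt (hdot W A A).

Definition pairing A B : R := \int[lebesgue_rV]_y frob (A y) (B y).

End weighted_spaces.

Section bochner.
Context {R : realType} {m : nat} (W : 'rV[R]_m -> 'M[R]_m).
Local Notation field := ('rV[R]_m -> 'M[R]_m).
Local Notation mu := (@lebesgue_measure R).

Record hsimple := HSimple {
  hs_size : nat ;
  hs_set : 'I_hs_size -> set R ;
  hs_val : 'I_hs_size -> field ;
  hs_measurable : forall k, measurable (hs_set k : set (measurableTypeR R)) ;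
  hs_finite : forall k, (mu (hs_set k) < +oo)%E ;
  hs_inH : forall k, inH W (hs_val k) }.

Definition hs_fun (f : hsimple) (s : R) : field :=
  \sum_(k < hs_size f) (\1_(hs_set k) s : R) *: hs_val k.

Definition hs_integral (D : set R) (f : hsimple) : field :=
  \sum_(k < hs_size f) fine (mu (D `&` hs_set k)) *: hs_val k.

Definition ae_cvg (D : set R) (f : nat -> hsimple) (C : R -> field) : Prop :=
  {ae mu, forall s, D s ->
    hnorm W (C s - hs_fun (f n) s) @[n --> \oo] --> (0 : R)}.

Definition strongly_measurable (D : set R) (C : R -> field) : Prop :=
  exists f, ae_cvg D f C.

Definition is_bochner_integral (D : set R) (C : R -> field) (X : field) : Prop :=
  inH W X /\ exists f : nat -> hsimple,
    [/\ ae_cvg D f C,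
        (\int[mu]_(s in D) (hnorm W (C s - hs_fun (f n) s))%:E)%E
          @[n --> \oo] --> 0%E
      & hnorm W (X - hs_integral D (f n)) @[n --> \oo] --> (0 : R)].

(* Well defined up to a field of zero norm; 0 if C is not integrable on D. *)
Definition bochner (D : set R) (C : R -> field) : field :=
  xget 0 [set X | is_bochner_integral D C X].

Definition Linfty_H (C : R -> field) : Prop :=
  [/\ forall s, inH W (C s), strongly_measurable setT C
    & exists M : R, {ae mu, forall s, hnorm W (C s) <= M}].

Definition continuous_H (T : R) (B : R -> field) : Prop :=
  (forall t, t \in `[0, T] -> inH W (B t)) /\
  forall t, t \in `[0, T] ->
    hnorm W (B s - B t) @[s --> within `[0, T]%classic (nbhs t)] --> (0 : R).

End bochner.

(* Main.v *)
Require Import Defs.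
From HB Require Import structures.
From mathcomp Require Import all_boot all_order all_algebra.
From mathcomp Require Import all_classical all_reals all_analysis.
From mathcomp Require Import measurable_realfun ring lra.

Set Implicit Arguments.
Unset Strict Implicit.
Unset Printing Implicit Defensive.
Import Order.TTheory GRing.Theory Num.Theory.
Import numFieldNormedType.Exports.

Local Open Scope classical_set_scope.
Local Open Scope ring_scope.

(* The field A |-> P A P is an isometry of H_P onto H_Q that turns the pairing
   int A : B into the scalar product of H_Q, so everything takes place in the
   Hilbert space H_Q.  Cut [0, T] into n intervals of length h.  On the interval
   starting at t0, replacing B(t) by B(t0) costs at most omega(h) times the
   length and a bound of C - Cbar; after this replacement, the integral of
   C(t / eps) over the interval is h times a mean of C over a window of length
   S = h / eps, which is uniformly close to Cbar once eps is small.  The L^1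
   bound and the common modulus give |B(t)|_P <= K / T + omega(T), so both errors
   are uniform in B.  The Bochner integrals exist because H_Q is complete
   (Riesz-Fischer), and they commute with A |-> (., A)_Q. *)

(** * Positive definite weights *)

(** The Bochner integral is available only as a limit of integrals of simple functions. Vector
    estimates are therefore tested: paired with a fixed field, an integral of fields becomes a
    scalar Lebesgue integral, where dominated convergence and the dilation [s = t / eps] apply. A
    norm is recovered by testing a field against itself.

    The other obstacle is that [C] is controlled only almost everywhere, so the scalar functions
    built from it may be nonmeasurable. They are exchanged for those of a better version of [C], by
    comparing integrals of arbitrary functions that agree off a null set.

    The order of the choices gives uniformity in [B]. The length [h] depends on [e], [T], [omega]
    and the bounds on [C] and [Cbar]; the window threshold depends also on the common bound of the
    |B(t)|_P; [eps] comes next, and [B] last. The windows start at [k h / eps], which for k > 0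
    escapes to infinity as [eps] tends to 0; this is where uniformity of the means in [s0]
    enters. *)

Section frobenius.
Context {R : realType} {m : nat}.
Implicit Types A B L W : 'M[R]_m.

Lemma frobE A B : frob A B = \sum_i \sum_j A i j * B i j.
Proof.
rewrite /frob /mxtrace exchange_big /=; apply: eq_bigr => j _.
by rewrite mxE; apply: eq_bigr => i _; rewrite mxE.
Qed.

Lemma frobC A B : frob A B = frob B A.
Proof.
rewrite !frobE; apply: eq_bigr => i _; apply: eq_bigr => j _; exact: mulrC.
Qed.

Lemma frobDr A B B' : frob A (B + B') = frob A B + frob A B'.
Proof. by rewrite /frob mulmxDr mxtraceD. Qed.

Lemma frobZr A k B : frob A (k *: B) = k * frob A B.
Proof. by rewrite /frob -scalemxAr mxtraceZ. Qed.

Lemma frob_ge0 A : 0 <= frob A A.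
Proof.
rewrite frobE; apply: sumr_ge0 => i _; apply: sumr_ge0 => j _.
by rewrite -expr2 sqr_ge0.
Qed.

(** This is |xA + B|^2 expanded. Nonnegativity of a polynomial in [x] is the form of Cauchy-Schwarz
    that survives integration. *)
Lemma frob_quad A B (x : R) :
  0 <= frob A A * x ^+ 2 + 2 * frob A B * x + frob B B.
Proof.
have := frob_ge0 (x *: A + B); rewrite frobDr frobZr ![frob (_ + _) _]frobC.
by rewrite !frobDr !frobZr (frobC B A) => /le_trans; apply; lra.
Qed.

Lemma frob_delta_mx i j A : frob (delta_mx i j) A = A i j.
Proof.
rewrite frobE (bigD1 i)//= (bigD1 j)//= mxE !eqxx mul1r big1 ?addr0 => [|k kj].
  rewrite big1 ?addr0// => k ki; rewrite big1// => l _.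
  by rewrite mxE (negbTE ki) mul0r.
by rewrite mxE (negbTE kj) andbF mul0r.
Qed.

(** Semidefiniteness in factored form: by [gram_frob], the weighted form is the plain Frobenius
    product after A |-> L^T A L, so its positivity and symmetry are inherited. *)
Definition gram W := exists L : 'M[R]_m, W = L *m L^T.

Lemma gram_frob L A B :
  frob ((L *m L^T) *m A) (B *m (L *m L^T)) =
  frob (L^T *m A *m L) (L^T *m B *m L).
Proof. by rewrite /frob !trmx_mul !trmxK !mulmxA mxtrace_mulC !mulmxA. Qed.

Lemma gram_quad W A B (x : R) : gram W ->
  0 <= frob (W *m A) (A *m W) * x ^+ 2 + 2 * frob (W *m A) (B *m W) * x
       + frob (W *m B) (B *m W).
Proof. by case=> L ->; rewrite !gram_frob frob_quad. Qed.

Lemma gram_frobC W A B : gram W ->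
  frob (W *m A) (B *m W) = frob (W *m B) (A *m W).
Proof. by case=> L ->; rewrite !gram_frob frobC. Qed.

Lemma gram_ge0 W A : gram W -> 0 <= frob (W *m A) (A *m W).
Proof. by case=> L ->; rewrite gram_frob frob_ge0. Qed.

End frobenius.

Section cholesky.
Context {R : realType}.

(** Induction through the Schur complement: with blocks a, v, D of S, the factor has first column
    (sqrt a, v / sqrt a) and lower right block a factor of D - v v^T / a. *)
Lemma spd_cholesky m (S : 'M[R]_m) : spd S ->
  exists2 L : 'M[R]_m, L \in unitmx & S = L *m L^T.
Proof.
elim: m S => [|m IH] S [ST S0].
  by exists 1%:M; [exact: unitmx1|rewrite !flatmx0; apply/matrixP => -[]].
change ('M[R]_(1 + m)) in S.
have {}S0 (xi : 'cV[R]_(1 + m)) : xi != 0 -> 0 < (xi^T *m S *m xi) ord0 ord0.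
  exact: S0.
set a := S ord0 ord0; set v := dlsubmx S; set D := drsubmx S.
have aE : ulsubmx S = a%:M.
  rewrite [LHS]mx11_scalar; congr (_%:M); rewrite !mxE; congr (S _ _);
    exact/val_inj.
have SE : S = block_mx a%:M v^T v D.
  rewrite -[LHS]submxK aE; congr block_mx.
  by rewrite /v -{2}ST trmx_dlsub trmxK.
have quad (t : 'M[R]_1) (xi : 'cV[R]_m) :
    (col_mx t xi)^T *m S *m col_mx t xi =
    a *: (t^T *m t) + t^T *m v^T *m xi + (xi^T *m v *m t + xi^T *m D *m xi).
  rewrite SE tr_col_mx mul_row_block mul_row_col !mulmxDl -!mulmxA mul_scalar_mx.
  by rewrite -scalemxAr !addrA; congr (_ + _); rewrite addrAC.
have a0 : 0 < a.
  have := S0 (col_mx (1%:M : 'M[R]_1) (0 : 'cV[R]_m)).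
  rewrite quad !(mulmx0, mul0mx, trmx0) !addr0.
  rewrite trmx1 mulmx1 !mxE/= mulr1; apply.
  by rewrite col_mx_eq0 negb_and (matrix_nonzero1 R 0).
have DT : D^T = D by rewrite /D -{2}ST trmx_drsub.
have sD : spd (D - a^-1 *: (v *m v^T)).
  split.
    by rewrite !linearB/= !linearZ/= trmx_mul trmxK DT.
  move=> xi xi0.
  (* For fixed [xi], this first coordinate minimises the form of [S]; the minimum is the form of the
     Schur complement at [xi]. *)
  have := S0 (col_mx (- a^-1 *: (v^T *m xi)) xi); rewrite quad.
  have -> : a *: ((- a^-1 *: (v^T *m xi))^T *m (- a^-1 *: (v^T *m xi)))
    + (- a^-1 *: (v^T *m xi))^T *m v^T *m xi +
    (xi^T *m v *m (- a^-1 *: (v^T *m xi)) + xi^T *m D *m xi)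
    = xi^T *m (D - a^-1 *: (v *m v^T)) *m xi.
    set w := v^T *m xi.
    have wT : xi^T *m v = w^T by rewrite trmx_mul trmxK.
    rewrite mulmxBr mulmxBl linearZ/= -!scalemxAr -!scalemxAl.
    rewrite (mulmxA xi^T v) wT -!(mulmxA w^T) -/w scalerA.
    rewrite mulrN divff ?gt_eqF// scaleN1r -[_ *m v^T *m xi]mulmxA -/w.
    by rewrite addNr add0r scaleNr addrC.
  by apply; rewrite col_mx_eq0 (negbTE xi0) andbF.
have [L' uL' L'E] := IH _ sD.
pose s := Num.sqrt a.
have s0 : s != 0 by rewrite gt_eqF// sqrtr_gt0.
have ss : s * s = a by rewrite -expr2 sqr_sqrtr// ltW.
change (exists2 L : 'M[R]_(1 + m), L \in unitmx & S = L *m L^T).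
exists (block_mx s%:M 0 (s^-1 *: v) L').
  rewrite unitmxE det_lblock unitrM -(unitmxE L') uL' andbT det_scalar expr1.
  by rewrite unitfE.
rewrite tr_block_mx mulmx_block !(trmx0, mulmx0, mul0mx) !addr0 tr_scalar_mx.
rewrite -L'E -scalar_mxM ss {1}SE; congr block_mx.
- by rewrite mul_scalar_mx linearZ/= scalerA divff// scale1r.
- by rewrite mul_mx_scalar scalerA divff// scale1r.
- rewrite linearZ/= -scalemxAl -scalemxAr scalerA -invfM ss.
  by rewrite addrC subrK.
Qed.

Lemma spd_unitmx m (S : 'M[R]_m) : spd S -> S \in unitmx.
Proof. by move=> /spd_cholesky[L uL ->]; rewrite unitmx_mul unitmx_tr uL. Qed.

Lemma spd_gramV m (S : 'M[R]_m) : spd S -> gram (invmx S).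
Proof.
move=> /spd_cholesky[L uL ->]; exists (invmx L)^T; rewrite trmxK trmx_inv.
have uLT : L^T \in unitmx by rewrite unitmx_tr.
have uLL : L *m L^T \in unitmx by rewrite unitmx_mul uL.
apply: (can_inj (mulKmx uLL)); rewrite mulmxV//.
by rewrite mulmxA -(mulmxA L) mulmxV// mulmx1 mulmxV.
Qed.

Lemma gram_tr m (W : 'M[R]_m) : gram W -> W^T = W.
Proof. by case=> L ->; rewrite trmx_mul trmxK. Qed.

(* [A |-> W^-1 A W^-1] turns the duality [tr(A^T B)] into the scalar product
   of weight [W]. *)
Lemma frob_dual m (W A B : 'M[R]_m) : gram W -> W \in unitmx ->
  frob (W *m (invmx W *m A *m invmx W)) (B *m W) = frob A B.
Proof.
move=> /gram_tr WT uW; rewrite /frob -mulmxA mulKVmx// trmx_mul trmx_inv WT.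
by rewrite -mulmxA mxtrace_mulC -!mulmxA mulmxV// mulmx1.
Qed.

End cholesky.

(** * The weighted L2 spaces *)

(** For a > 0, evaluate at the minimum x = -c/a. For a = 0 the polynomial is affine, and a nonzero
    slope would let it take the value -1. The degenerate case occurs for fields of zero norm. *)
Lemma real_quad_discr {R : realFieldType} (a b c : R) : 0 <= a ->
  (forall x, 0 <= a * x ^+ 2 + 2 * c * x + b) -> c ^+ 2 <= a * b.
Proof.
rewrite le_eqVlt => /predU1P[<- h|a0 h]; last first.
  have := mulr_ge0 (ltW a0) (h (- (c / a))); rewrite -[c ^+ 2 <= _]subr_ge0.
  suff -> : a * (a * (- (c / a)) ^+ 2 + 2 * c * - (c / a) + b) = a * b - c ^+ 2.
    exact.
  by field; rewrite gt_eqF.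
have [->|c0] := eqVneq c 0; first by rewrite expr0n mul0r.
have := h (- (b + 1) / (2 * c)).
have -> : 0 * (- (b + 1) / (2 * c)) ^+ 2 + 2 * c * (- (b + 1) / (2 * c)) + b = -1.
  by field.
by rewrite lerNr oppr0 ler10.
Qed.

Section integral_cauchy_schwarz.
Context d {Y : measurableType d} {R : realType} (mu : {measure set Y -> \bar R}).
Variables a b c : Y -> R.
Hypothesis ia : mu.-integrable setT (EFin \o a).
Hypothesis ib : mu.-integrable setT (EFin \o b).
Hypothesis mc : measurable_fun setT c.
Hypotheses (a_ge0 : forall y, 0 <= a y) (b_ge0 : forall y, 0 <= b y).
Hypothesis quad : forall y x, 0 <= a y * x ^+ 2 + 2 * c y * x + b y.

(** The values of the polynomial at x = 1 and x = -1 give 2|c| <= a + b. *)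
Lemma quad_integrable : mu.-integrable setT (EFin \o c).
Proof.
apply: (le_integrable _ _ _ (integrableD measurableT ia ib)) => //.
  exact/measurable_EFinP.
move=> y _ /=; rewrite lee_fin [leRHS]ger0_norm ?addr_ge0// ler_norml.
have := quad y 1; have := quad y (-1); have := a_ge0 y; have := b_ge0 y.
by rewrite sqrrN expr1n !mulr1 mulrN1 => ? ? ? ?; apply/andP; split; lra.
Qed.

(** Integrating the pointwise polynomial gives a nonnegative polynomial in [x] whose coefficients
    are the integrals; its discriminant is the claim. *)
Lemma quad_Rintegral_norm :
  `|\int[mu]_y c y| <= Num.sqrt (\int[mu]_y a y) * Num.sqrt (\int[mu]_y b y).
Proof.
have ic := quad_integrable.
have a0 : 0 <= \int[mu]_y a y by apply: Rintegral_ge0.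
rewrite -sqrtrM// -sqrtr_sqr ler_wsqrtr// real_quad_discr// => x.
have iax : mu.-integrable setT (EFin \o (fun y => x ^+ 2 * a y)).
  exact: (@integrableZl _ _ _ mu _ measurableT (x ^+ 2) _ ia).
have icx : mu.-integrable setT (EFin \o (fun y => (2 * x) * c y)).
  exact: (@integrableZl _ _ _ mu _ measurableT (2 * x) _ ic).
have : 0 <= \int[mu]_y (x ^+ 2 * a y + (2 * x) * c y + b y).
  apply: Rintegral_ge0 => y _.
  suff -> : x ^+ 2 * a y + 2 * x * c y + b y =
            a y * x ^+ 2 + 2 * c y * x + b y by exact: quad.
  by ring.
rewrite RintegralD ?RintegralD ?RintegralZl//; last first.
  exact: (integrableD measurableT iax icx).
by move=> /le_trans; apply; rewrite le_eqVlt; apply/orP; left; apply/eqP; ring.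
Qed.

End integral_cauchy_schwarz.

Section measurable_matrix_field.
Context d {Y : measurableType d} {R : realType} {m : nat}.
Implicit Types A B : Y -> 'M[R]_m.

Lemma measurable_mulmx A B : measurable_fun setT A -> measurable_fun setT B ->
  measurable_fun setT (fun y => A y *m B y).
Proof.
move=> /measurable_fun_mxP mA /measurable_fun_mxP mB.
apply/measurable_fun_mxP => i j; under eq_fun do rewrite mxE.
by apply: measurable_sum => k; exact: measurable_funM.
Qed.

Lemma measurable_frob A B : measurable_fun setT A -> measurable_fun setT B ->
  measurable_fun setT (fun y => frob (A y) (B y)).
Proof.
move=> /measurable_fun_mxP mA /measurable_fun_mxP mB.
under eq_fun do rewrite frobE.
by do 2 (apply: measurable_sum => ?); exact: measurable_funM.
Qed.

Lemma measurable_addmx A B : measurable_fun setT A -> measurable_fun setT B ->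
  measurable_fun setT (A + B).
Proof.
move=> /measurable_fun_mxP mA /measurable_fun_mxP mB.
apply/measurable_fun_mxP => i j.
rewrite (_ : (fun _ => _) = (fun y => A y i j) \+ (fun y => B y i j)).
  exact: measurable_funD.
by apply/funext => y; rewrite mxE.
Qed.

Lemma measurable_scalemx (k : R) A : measurable_fun setT A ->
  measurable_fun setT (k *: A).
Proof.
move=> /measurable_fun_mxP mA; apply/measurable_fun_mxP => i j.
rewrite (_ : (fun _ => _) = (fun y => k * A y i j)).
  exact: measurable_funM.
by apply/funext => y; rewrite mxE.
Qed.

End measurable_matrix_field.

Lemma frobNN {R : realType} {m : nat} (A B : 'M[R]_m) :
  frob (- A) (- B) = frob A B.
Proof.
by rewrite !frobE; do 2 (apply: eq_bigr => ? _); rewrite !mxE mulrNN.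
Qed.

Section weighted_space.
Context {R : realType} {m : nat} (W : 'rV[R]_m -> 'M[R]_m).
Hypothesis mW : measurable_fun setT W.
Hypothesis gW : forall y, gram (W y).
Local Notation field := ('rV[R]_m -> 'M[R]_m).
Local Notation mu := (@lebesgue_rV R m).
Implicit Types A B D : field.

Let qf A B y := frob (W y *m A y) (B y *m W y).

Lemma measurable_qf A B : measurable_fun setT A -> measurable_fun setT B ->
  measurable_fun setT (fun y => frob (W y *m A y) (B y *m W y)).
Proof. by move=> mA mB; apply: measurable_frob; exact: measurable_mulmx. Qed.

Let qf_ge0 A y : 0 <= qf A A y. Proof. exact: gram_ge0. Qed.

Let qf_quad A B y x : 0 <= qf A A y * x ^+ 2 + 2 * qf A B y * x + qf B B y.
Proof. exact: gram_quad. Qed.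

Let qfC A B y : qf A B y = qf B A y. Proof. exact: gram_frobC. Qed.

Let qfDl A B D y : qf (A + B) D y = qf A D y + qf B D y.
Proof. by rewrite qfC /qf mulmxDl frobDr -/(qf D A y) -/(qf D B y) !(qfC D). Qed.

Let qfZl k A D y : qf (k *: A) D y = k * qf A D y.
Proof. by rewrite qfC /qf -scalemxAl frobZr -/(qf D A y) qfC. Qed.

Lemma inH_measurable A : inH W A -> measurable_fun setT A.
Proof. by case. Qed.

Lemma inH_integrable A : inH W A ->
  mu.-integrable setT (EFin \o qf A A).
Proof.
move=> [mA fA]; apply/integrableP; split.
  by apply/measurable_EFinP; exact: measurable_qf.
by under eq_integral do rewrite /= ger0_norm//.
Qed.

Lemma integrable_inH A : measurable_fun setT A ->
  mu.-integrable setT (EFin \o qf A A) -> inH W A.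
Proof.
move=> mA /integrableP[_]; split => //; move: b.
by under eq_integral do rewrite /= ger0_norm//.
Qed.

Lemma hdot_integrable A B : inH W A -> inH W B ->
  mu.-integrable setT (EFin \o qf A B).
Proof.
move=> hA hB; apply: (@quad_integrable _ _ _ mu (qf A A) (qf B B)) => //.
- exact: inH_integrable.
- exact: inH_integrable.
- by apply: measurable_qf; [case: hA|case: hB].
Qed.

Lemma hdot_norm A B : inH W A -> inH W B ->
  `|hdot W A B| <= hnorm W A * hnorm W B.
Proof.
move=> hA hB; apply: (@quad_Rintegral_norm _ _ _ mu (qf A A) (qf B B)) => //.
- exact: inH_integrable.
- exact: inH_integrable.
- by apply: measurable_qf; [case: hA|case: hB].
- by move=> y x; exact: qf_quad.
Qed.

Lemma hdotC A B : hdot W A B = hdot W B A.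
Proof. by apply: eq_Rintegral => y _; exact: qfC. Qed.

Lemma inHZ k A : inH W A -> inH W (k *: A).
Proof.
move=> hA; apply: integrable_inH; first by apply: measurable_scalemx; case: hA.
rewrite (_ : _ \o _ = (fun y => (k ^+ 2)%:E * (EFin \o qf A A) y)%E).
  by apply: integrableZl => //; exact: inH_integrable.
by apply/funext => y; rewrite /= -EFinM qfZl qfC qfZl mulrA.
Qed.

Lemma inHD A B : inH W A -> inH W B -> inH W (A + B).
Proof.
move=> hA hB; apply: integrable_inH.
  by apply: measurable_addmx; exact: inH_measurable.
rewrite (_ : _ \o _ = (EFin \o qf A A) \+ (EFin \o qf A B) \+
    ((EFin \o qf A B) \+ (EFin \o qf B B)))%E.
  by do !apply: integrableD => //; (exact: inH_integrable || exact: hdot_integrable).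
apply/funext => y; rewrite /= -!EFinD qfDl !(qfC _ (A + B)) !qfDl.
by rewrite (qfC B A).
Qed.

Lemma inH0 : inH W 0.
Proof.
apply: integrable_inH; first exact: measurable_cst.
rewrite (_ : _ \o _ = cst 0%E); first exact: integrable0.
by apply/funext => y; rewrite /= /qf mul0mx /frob mulmx0 mxtrace0.
Qed.

Lemma inHB A B : inH W A -> inH W B -> inH W (A - B).
Proof. by move=> hA hB; rewrite -(scaleN1r B); apply: inHD => //; exact: inHZ. Qed.

Lemma inH_sum n (A : 'I_n -> field) : (forall k, inH W (A k)) ->
  inH W (\sum_k A k).
Proof.
by move=> hA; elim/big_ind : _ => //; [exact: inH0|exact: inHD].
Qed.

Lemma hdotDl A B D : inH W A -> inH W B -> inH W D ->
  hdot W (A + B) D = hdot W A D + hdot W B D.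
Proof.
move=> hA hB hD; rewrite -RintegralD//; try exact: hdot_integrable.
by apply: eq_Rintegral => y _; exact: qfDl.
Qed.

Lemma hdotZl k A D : inH W A -> inH W D -> hdot W (k *: A) D = k * hdot W A D.
Proof.
move=> hA hD; rewrite -RintegralZl//; last exact: hdot_integrable.
by apply: eq_Rintegral => y _; exact: qfZl.
Qed.

Lemma hdotBl A B D : inH W A -> inH W B -> inH W D ->
  hdot W (A - B) D = hdot W A D - hdot W B D.
Proof.
move=> hA hB hD; rewrite -(scaleN1r B) hdotDl ?hdotZl ?mulN1r//.
exact: inHZ.
Qed.

Lemma hdot_suml n (A : 'I_n -> field) D : (forall k, inH W (A k)) -> inH W D ->
  hdot W (\sum_k A k) D = \sum_k hdot W (A k) D.
Proof.
(* Additivity of [hdot] requires membership of both summands, so membership is carried along in the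
   induction. *)
move=> hA hD; have : inH W (\sum_k A k) /\
    hdot W (\sum_k A k) D = \sum_k hdot W (A k) D; last by case.
elim/big_ind2 : _ => [|A1 x1 A2 x2 [h1 e1] [h2 e2]|k _]; last by [].
  split; first exact: inH0.
  by rewrite -(scale0r (0 : field)) hdotZl// ?mul0r//; exact: inH0.
by split; [exact: inHD|rewrite hdotDl// e1 e2].
Qed.

Lemma hdot_ge0 A : 0 <= hdot W A A.
Proof. by apply: Rintegral_ge0 => y _; exact: qf_ge0. Qed.

Lemma sqr_hnorm A : hnorm W A ^+ 2 = hdot W A A.
Proof. by rewrite sqr_sqrtr// hdot_ge0. Qed.

Lemma hnorm_ge0 A : 0 <= hnorm W A. Proof. exact: sqrtr_ge0. Qed.

Lemma hnormZ k A : inH W A -> hnorm W (k *: A) = `|k| * hnorm W A.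
Proof.
move=> hA; have hkA := inHZ k hA.
rewrite /hnorm hdotZl// [hdot W A _]hdotC hdotZl// mulrA -expr2.
by rewrite sqrtrM ?sqr_ge0// sqrtr_sqr.
Qed.

Lemma hnormN A : hnorm W (- A) = hnorm W A.
Proof.
congr Num.sqrt; apply: eq_Rintegral => y _.
change ((- A) y) with (- A y).
by rewrite mulmxN mulNmx frobNN.
Qed.

Lemma hnorm_distC A B : hnorm W (A - B) = hnorm W (B - A).
Proof. by rewrite -hnormN opprB. Qed.

Lemma hnormD A B : inH W A -> inH W B ->
  hnorm W (A + B) <= hnorm W A + hnorm W B.
Proof.
move=> hA hB; have hAB := inHD hA hB.
rewrite -(@ler_sqr _ (hnorm W _)) ?nnegrE ?addr_ge0 ?hnorm_ge0// sqr_hnorm.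
rewrite hdotDl// ![hdot W _ (A + B)]hdotC !hdotDl// sqrrD !sqr_hnorm (hdotC B A).
have := le_trans (ler_norm _) (hdot_norm hA hB); lra.
Qed.

Lemma hnorm_triangle D A B : inH W A -> inH W B -> inH W D ->
  hnorm W (A - B) <= hnorm W (A - D) + hnorm W (D - B).
Proof.
move=> hA hB hD; rewrite (_ : A - B = (A - D) + (D - B)) ?hnormD//.
- exact: inHB.
- exact: inHB.
- by rewrite addrA subrK.
Qed.

Lemma hnorm0 : hnorm W 0 = 0.
Proof. by rewrite -(scale0r (0 : field)) hnormZ ?normr0 ?mul0r//; exact: inH0. Qed.

Lemma hnorm_le_dist A B : inH W A -> inH W B ->
  `|hnorm W A - hnorm W B| <= hnorm W (A - B).
Proof.
move=> hA hB; rewrite ler_norml; apply/andP; split.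
  have := hnorm_triangle hB inH0 hA; rewrite !subr0 hnorm_distC; lra.
have := hnorm_triangle hA inH0 hB; rewrite !subr0; lra.
Qed.

End weighted_space.

(** * Duality between H_P and H_Q *)

Section duality.
Context {R : realType} {m : nat} (P Q : 'rV[R]_m -> 'M[R]_m).
Hypothesis mP : measurable_fun setT P.
Hypothesis sP : forall y, spd (P y).
Hypothesis PQ : forall y, Q y = invmx (P y).
Local Notation field := ('rV[R]_m -> 'M[R]_m).
Implicit Types A B : field.

Definition dual_field A : field := fun y => P y *m A y *m P y.

Let gQ y : gram (Q y). Proof. by rewrite PQ; exact: spd_gramV. Qed.

Let uQ y : Q y \in unitmx. Proof. by rewrite PQ unitmx_inv spd_unitmx. Qed.

Let PE y : P y = invmx (Q y). Proof. by rewrite PQ invmxK. Qed.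

Lemma pairingE A B : pairing A B = hdot Q (dual_field A) B.
Proof.
by apply: eq_Rintegral => y _; rewrite /dual_field PE frob_dual.
Qed.

(** By [frob_dual] the left side is A : PAP; moving the symmetric factor P across the trace gives PA
    : AP. *)
Let qf_dual A y :
  frob (Q y *m dual_field A y) (dual_field A y *m Q y) =
  frob (P y *m A y) (A y *m P y).
Proof.
rewrite {1}/dual_field {1 2}PE frob_dual// /frob trmx_mul (sP y).1.
by rewrite /dual_field !mulmxA.
Qed.

Lemma hnorm_dual A : hnorm Q (dual_field A) = hnorm P A.
Proof. by congr Num.sqrt; apply: eq_Rintegral => y _; exact: qf_dual. Qed.

Lemma inH_dual A : inH P A -> inH Q (dual_field A).
Proof.
move=> [mA fA]; split.
  by apply: measurable_mulmx => //; exact: measurable_mulmx.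
by under eq_integral do rewrite qf_dual.
Qed.

Lemma dual_fieldB A B : dual_field (A - B) = dual_field A - dual_field B.
Proof.
apply/funext => y; rewrite /dual_field.
change ((A - B) y) with (A y - B y); rewrite mulmxBr mulmxBl; reflexivity.
Qed.

End duality.

(** * Completeness *)

Section geometric_bounds.
Context {R : realType}.

Lemma cvgn_geometric_diff (u : R^nat) (c : R) :
  (forall n, `|u n.+1 - u n| <= c * 2^-1 ^+ n) -> cvgn u.
Proof.
move=> uc; rewrite (_ : u = fun n => u 0 + series (telescope u) n); last first.
  by apply/funext => n; exact: eq_sum_telescope.
apply: is_cvgD; first exact: is_cvg_cst.
apply: normed_cvg; apply: (@series_le_cvg _ _ (geometric c 2^-1)) => [n|n|n|].
- exact: normr_ge0.
- by exact: (le_trans (normr_ge0 _) (uc n)).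
- exact: uc.
- apply: is_cvg_geometric_series.
  by rewrite ger0_norm ?invr_ge0// invf_lt1 ?ltr1n.
Qed.

(** The series of the [g n] has integral at most 2, so its sum is finite almost everywhere, and the
    sum bounds each term. *)
Lemma ae_bounded_geometric d (Y : measurableType d)
    (mu : {measure set Y -> \bar R}) (g : nat -> Y -> R) :
  (forall n, measurable_fun setT (g n)) -> (forall n y, 0 <= g n y) ->
  (forall n, \int[mu]_y (g n y)%:E <= (2^-1 ^+ n)%:E)%E ->
  {ae mu, forall y, exists c, forall n, g n y <= c}.
Proof.
move=> mg g0 gle; have g0E n y : (0 <= (g n y)%:E)%E by rewrite lee_fin.
pose s y := (\sum_(n <oo) (g n y)%:E)%E.
have is_ : mu.-integrable setT s.
  apply/integrableP; split.
    apply: (@ge0_emeasurable_sum _ _ _ setT (fun n y => (g n y)%:E) xpredT).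
      by move=> n y _ _; exact: g0E.
    by move=> n _; exact/measurable_EFinP.
  rewrite (eq_integral s); last first.
    by move=> y _; rewrite gee0_abs// nneseries_ge0// => n _ _; exact: g0E.
  rewrite integral_nneseries//; last by move=> n; exact/measurable_EFinP.
  apply: (@le_lt_trans _ _ 2%:E); last exact: ltry.
  apply: lime_le; first apply: is_cvg_nneseries => n _ _.
    by apply: integral_ge0 => y _; exact: g0E.
  apply: nearW => n; rewrite /=.
  apply: (@le_trans _ _ (\sum_(0 <= k < n) (2^-1 ^+ k)%:E)%E).
    by apply: lee_sum => k _; exact: gle.
  rewrite sumEFin lee_fin.
  suff -> : \sum_(0 <= k < n) (2^-1 : R) ^+ k = 2 - 2 * 2^-1 ^+ n.
    by rewrite gerBl mulr_ge0// exprn_ge0// invr_ge0.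
  elim: n => [|n IH]; first by rewrite big_nil expr0 mulr1 subrr.
  by rewrite big_nat_recr//= IH exprS; field.
apply: filterS (integrable_ae measurableT is_) => y /(_ I) sy.
exists (fine (s y)) => n; rewrite -lee_fin fineK//.
apply: le_trans (nneseries_lim_ge (m := 0) (P := xpredT) n.+1 _); last first.
  by move=> k _ _; exact: g0E.
rewrite big_nat_recr//= leeDr// sume_ge0// => k _; exact: g0E.
Qed.

Lemma limn_einf_le (u : (\bar R)^nat) (x : \bar R) :
  (forall n, u n <= x)%E -> (limn_einf u <= x)%E.
Proof.
move=> ux; rewrite limn_einf_lim; apply: lime_le; first exact: is_cvg_einfs.
apply: nearW => n; apply: le_trans (ux n).
by apply: ereal_inf_lbound; exists n => /=.
Qed.

End geometric_bounds.

Section completeness.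
Context {R : realType} {m : nat} (W : 'rV[R]_m -> 'M[R]_m).
Hypothesis mW : measurable_fun setT W.
Hypothesis gW : forall y, gram (W y).
Hypothesis uW : forall y, W y \in unitmx.
Local Notation field := ('rV[R]_m -> 'M[R]_m).
Local Notation mu := (@lebesgue_rV R m).
Implicit Types A B : field.

Let qf A y := frob (W y *m A y) (A y *m W y).

Lemma integral_hnorm A : inH W A ->
  (\int[mu]_y (frob (W y *m A y) (A y *m W y))%:E = (hnorm W A ^+ 2)%:E)%E.
Proof.
move=> hA; rewrite sqr_hnorm//.
rewrite /hdot /Rintegral fineK//; apply: integrable_fin_num => //.
exact: inH_integrable.
Qed.

Let entry_dual i j y := invmx (W y) *m delta_mx i j *m invmx (W y).

(** An entry of [A] is the weighted product of [A] with W^-1 E_ij W^-1, so pointwise Cauchy-Schwarz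
    applies. The factor depends on [y] but not on [A]: smallness in H_W thus controls entries at
    each point. *)
Lemma sqr_entry_le A y i j :
  A y i j ^+ 2 <= frob (W y *m entry_dual i j y) (entry_dual i j y *m W y)
                  * qf A y.
Proof.
rewrite -[A y i j](frob_delta_mx i j) -(frob_dual _ _ (gW y))//.
apply: real_quad_discr; first exact: gram_ge0.
by move=> x; exact: gram_quad.
Qed.

Lemma cvg_qf (M : nat -> 'M[R]_m) (S L : 'M[R]_m) :
  (forall i j, M n i j @[n --> \oo] --> L i j) ->
  frob (S *m M n) (M n *m S) @[n --> \oo] --> frob (S *m L) (L *m S).
Proof.
move=> ML; rewrite frobE; under eq_fun do rewrite frobE.
apply: cvg_big => // [|i _]; first exact: add_continuous.
apply: cvg_big => // [|j _]; first exact: add_continuous.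
apply: cvgM; rewrite mxE; under eq_fun do rewrite mxE.
  apply: cvg_big => // [|k _]; first exact: add_continuous.
  by apply: cvgM => //; exact: cvg_cst.
apply: cvg_big => // [|k _]; first exact: add_continuous.
by apply: cvgM => //; exact: cvg_cst.
Qed.

(* [4 ^ n |A_(n+1) - A_n|^2] has a finite sum of integrals, so it is bounded at
   almost every point and the entries converge there geometrically. *)
Lemma inH_fast_cauchy (A : nat -> field) : (forall n, inH W (A n)) ->
  (forall n, hnorm W (A n.+1 - A n) <= 4^-1 ^+ n) ->
  exists X : field, measurable_fun setT X /\
    {ae mu, forall y, forall i j, A n y i j @[n --> \oo] --> X y i j}.
Proof.
move=> hA Acau.
(* The upper limit exists at every point and is measurable, so [X] is a measurable field even where
   the entries diverge. *)
pose X y : 'M[R]_m := \matrix_(i, j) fine (limn_esup (fun n => (A n y i j)%:E)).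
exists X; split.
  apply/measurable_fun_mxP => i j; under eq_fun do rewrite mxE.
  apply: measurableT_comp => //.
  apply: measurable_fun_limn_esup => n; apply/measurable_EFinP.
  by have /measurable_fun_mxP := inH_measurable (hA n).
have hD n : inH W (A n.+1 - A n) by exact: inHB.
have mD n := inH_measurable (hD n).
have : {ae mu, forall y, exists c, forall n, 4 ^+ n * qf (A n.+1 - A n) y <= c}.
  apply: (@ae_bounded_geometric _ _ _ mu
    (fun n y => 4 ^+ n * qf (A n.+1 - A n) y)) => [n|n y|n].
  - by apply: measurable_funM => //; exact: measurable_qf.
  - by apply: mulr_ge0 => //; exact: gram_ge0.
  - under eq_integral do rewrite EFinM.
    rewrite ge0_integralZl_EFin//; last 2 first.
    + by move=> y _; rewrite lee_fin; exact: gram_ge0.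
    + by apply/measurable_EFinP; exact: measurable_qf.
    rewrite integral_hnorm// -EFinM lee_fin.
    (* The product is 4^-n, which is below the 2^-n required by [ae_bounded_geometric]. *)
    apply: (@le_trans _ _ (4 ^+ n * (4^-1 ^+ n) ^+ 2)).
      by rewrite ler_wpM2l// ler_sqr ?nnegrE ?hnorm_ge0 ?exprn_ge0// invr_ge0.
    rewrite expr2 mulrA -exprMn divff// expr1n mul1r.
    by rewrite lerXn2r ?nnegrE ?invr_ge0// lef_pV2 ?posrE// ler_nat.
apply: filterS => y [c yc] i j.
set p := frob (W y *m entry_dual i j y) (entry_dual i j y *m W y).
have p0 : 0 <= p by exact: gram_ge0.
have : cvgn (fun n => A n y i j).
  (* The squared increment is at most [p] times the weighted form, itself at most c / 4^n; the
     square root leaves the ratio 1/2. *)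
  apply: (@cvgn_geometric_diff _ _ (Num.sqrt (p * c))) => n.
  have := sqr_entry_le (A n.+1 - A n) y i j; rewrite -/p => h.
  have -> : A n.+1 y i j - A n y i j = (A n.+1 - A n) y i j by rewrite !mxE.
  rewrite -sqrtr_sqr.
  have -> : 2^-1 ^+ n = Num.sqrt (4^-1 ^+ n) :> R.
    rewrite -(@ger0_norm _ (2^-1 ^+ n)) ?exprn_ge0 ?invr_ge0//.
    rewrite -sqrtr_sqr -exprM mulnC exprM; congr (Num.sqrt (_ ^+ _)).
    by rewrite expr2 -invfM; congr (_^-1); ring.
  rewrite -sqrtrM ?mulr_ge0//; last first.
    by apply: le_trans (yc 0); rewrite mulr_ge0//; exact: gram_ge0.
  rewrite ler_wsqrtr// (le_trans h)// -mulrA ler_wpM2l//.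
  by rewrite exprVn ler_pdivlMr ?exprn_gt0// mulrC.
move=> cA; rewrite mxE; have cA' := cA.
have : (A n y i j)%:E @[n --> \oo] --> (limn (fun n => A n y i j))%:E.
  by apply: cvg_EFin; [exact: nearW|exact: cA].
move=> /cvg_limn_einf_sup[_ ->] /=; exact: cA.
Qed.

(** Almost everywhere the weighted form of [X] is the lower limit of those of [B n], so Fatou's
    lemma yields the bound, and with it membership in H_W. *)
Lemma fatou_hnorm (B : nat -> field) (X : field) (e : R) : 0 <= e ->
  (forall n, inH W (B n)) -> measurable_fun setT X ->
  {ae mu, forall y, forall i j, B n y i j @[n --> \oo] --> X y i j} ->
  (forall n, hnorm W (B n) <= e) -> inH W X /\ hnorm W X <= e.
Proof.
move=> e0 hB mX BX Be; pose f n y := (qf (B n) y)%:E.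
have mqf D : measurable_fun setT D -> measurable_fun setT (fun y => (qf D y)%:E).
  by move=> mD; apply/measurable_EFinP; exact: measurable_qf.
have f0 n y : (0 <= f n y)%E by rewrite lee_fin; exact: gram_ge0.
have mf n : measurable_fun setT (f n) by apply: mqf; exact: inH_measurable (hB n).
have Xe : (\int[mu]_y (qf X y)%:E <= (e ^+ 2)%:E)%E.
  rewrite (@ge0_ae_eq_integral _ _ _ mu setT _ (fun y => limn_einf (f ^~ y)))//.
  - apply: (le_trans (fatou _ _ _ _)) => //.
    apply: limn_einf_le => n; rewrite /f integral_hnorm// lee_fin.
    by rewrite ler_sqr ?nnegrE ?hnorm_ge0.
  - exact: mqf.
  - rewrite /limn_einf; apply: measurableT_comp => //.
    apply: measurable_fun_limn_esup => n; exact: measurableT_comp.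
  - by move=> y _; rewrite lee_fin; exact: gram_ge0.
  - move=> y _; rewrite limn_einf_lim; apply: lime_ge; first exact: is_cvg_einfs.
    by apply: nearW => n; apply: le_ereal_inf_tmp => _ [k _ <-]; exact: f0.
  - apply: filterS BX => y By _.
    have : (f n y @[n --> \oo] --> (qf X y)%:E)%E.
      by apply: cvg_EFin; [exact: nearW|exact: cvg_qf].
    by move=> /cvg_limn_einf_sup[-> _].
have hX : inH W X by split => //; exact: le_lt_trans Xe (ltry _).
split => //; move: Xe; rewrite integral_hnorm// lee_fin.
by rewrite ler_sqr ?nnegrE ?hnorm_ge0.
Qed.

Theorem inH_complete (A : nat -> field) : (forall n, inH W (A n)) ->
  (forall e, 0 < e -> exists N, forall k l, (N <= k)%N -> (N <= l)%N ->
    hnorm W (A k - A l) <= e) ->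
  exists2 X, inH W X & hnorm W (X - A n) @[n --> \oo] --> 0.
Proof.
move=> hA Acau.
have e_gt0 n : 0 < 4^-1 ^+ n :> R by rewrite exprn_gt0// invr_gt0.
have /choice[N NP] n := Acau _ (e_gt0 n).
(* The sum exceeds each of N 0, ..., N n, so every [u k] with k >= n lies beyond the threshold
   [N n]. *)
pose u n := (\sum_(i < n.+1) N i)%N.
have Nu n k : (n <= k)%N -> (N n <= u k)%N.
  move=> nk; rewrite /u (bigD1 (Ordinal (nk : (n < k.+1)%N)))//=; exact: leq_addr.
have [X [mX AX]] : exists X : field, measurable_fun setT X /\
    {ae mu, forall y, forall i j, A (u n) y i j @[n --> \oo] --> X y i j}.
  apply: inH_fast_cauchy => // n; apply: NP; apply: Nu => //; exact: leqnSn.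
have key n k : (N n <= k)%N -> inH W (X - A k) /\ hnorm W (X - A k) <= 4^-1 ^+ n.
  (* With [k] fixed, the Cauchy bound passes to the limit along the subsequence; the shift by [n]
     keeps its indices beyond [N n]. *)
  move=> nk; apply: (@fatou_hnorm (fun l => A (u (l + n)%N) - A k)).
  - exact: ltW.
  - by move=> l; exact: inHB.
  - rewrite -(scaleN1r (A k)); apply: measurable_addmx => //.
    by apply: measurable_scalemx; exact: inH_measurable (hA k).
  - apply: filterS AX => y Ay i j.
    have -> : (X - A k) y i j = X y i j - A k y i j by rewrite !mxE.
    under eq_fun => l.
      have -> : (A (u (l + n)%N) - A k) y i j = A (u (l + n)%N) y i j - A k y i j.
        by rewrite !mxE.
      over.
    apply: cvgB; last exact: cvg_cst.
    apply: (cvg_comp (addn^~ n) (fun l => A (u l) y i j)); last exact: Ay.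
    exact: cvg_addnr.
  - by move=> l; apply: NP => //; apply: Nu; exact: leq_addl.
have hX : inH W X.
  have [hX0 _] := key 0%N (N 0%N) (leqnn _).
  by rewrite -(subrK (A (N 0%N)) X); exact: inHD.
exists X => //; apply/cvgrPdist_le => e e0.
have /cvgrPdist_le/(_ _ e0)[n _ ne] : (4^-1 : R) ^+ n @[n --> \oo] --> 0.
  apply: cvg_expr; by rewrite ger0_norm ?invr_ge0// invf_lt1 ?ltr1n.
exists (N n) => // k nk; rewrite sub0r normrN ger0_norm ?hnorm_ge0//.
apply: (le_trans (key n k nk).2).
have := ne n (leqnn n); rewrite sub0r normrN ger0_norm//; exact: ltW.
Qed.

End completeness.

(** * Null sets and dilations *)

Section integral_null_set.
Local Open Scope ereal_scope.
Context d {Y : measurableType d} {R : realType} (mu : {measure set Y -> \bar R}).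
Variables (N : set Y).
Hypotheses (mN : measurable N) (N0 : mu N = 0).
Import HBNNSimple.

(* No measurability of [f] and [g]: [integral] is then a lower integral. *)
Lemma ge0_le_integral_null (D : set Y) (f g : Y -> \bar R) :
  (forall x, 0 <= f x) -> (forall x, 0 <= g x) ->
  (forall x, D x -> ~ N x -> f x <= g x) ->
  \int[mu]_(x in D) f x <= \int[mu]_(x in D) g x.
Proof.
move=> f0 g0 fg; rewrite !ge0_integralE//.
apply: ge_ereal_sup => _ [h /= hf <-].
(* Cutting [h] off on [N] keeps its integral and makes it a competitor in the supremum defining the
   integral of [g]. *)
pose h' := proj_nnsfun h (measurableC mN).
have mEh (k : {nnsfun Y >-> R}) : measurable_fun setT (fun x => (k x)%:E).
  exact/measurable_EFinP.
apply: ereal_sup_ubound; exists h' => [x|] /=.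
  have := hf x; rewrite mindicE !patchE; case: ifPn => [xD|_] hfx.
    have [xN|xN] := boolP (x \in ~` N); last by rewrite mulr0.
    rewrite mulr1; apply: le_trans hfx (fg x _ _); first exact: set_mem xD.
    exact: set_mem xN.
  by case: (_ \in _); rewrite ?mulr1// mulr0.
rewrite -!integralT_nnsfun; apply: ge0_ae_eq_integral => //.
- by move=> x _; rewrite lee_fin.
- by move=> x _; rewrite lee_fin.
exists N; split => // x /=; apply: contra_notP => xN _.
by rewrite mindicE mem_set// mulr1.
Qed.

Lemma eq_integral_null (D : set Y) (f g : Y -> \bar R) :
  (forall x, ~ N x -> f x = g x) -> \int[mu]_(x in D) f x = \int[mu]_(x in D) g x.
Proof.
move=> fg; rewrite integralE [RHS]integralE.
congr (_ - _); apply/eqP; rewrite eq_le; apply/andP; split;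
  by apply: ge0_le_integral_null => // x _ Nx; rewrite unlock /= fg.
Qed.

End integral_null_set.

Section lebesgue_scaling.
Context {R : realType}.
Local Notation mu := (@lebesgue_measure R).

(** Uniqueness of Lebesgue measure: the image measure under t |-> t / r, divided by [r], gives
    half-open intervals their length. *)
Lemma lebesgue_measure_scale (r : R) (A : set (measurableTypeR R)) : 0 < r ->
  measurable A -> mu ((fun t : R => t / r) @^-1` A) = (r%:E * mu A)%E.
Proof.
move=> r0 mA.
have mphi : measurable_fun [set: measurableTypeR R]
    ((fun t : R => t / r) : _ -> measurableTypeR R) by exact: mulrr_measurable.
have rV0 : 0 <= r^-1 by rewrite invr_ge0 ltW.
pose nu : {measure set (measurableTypeR R) -> \bar R} :=
  mscale (NngNum rV0)
   (measure_function_pushforward__canonical__measure_function_Measure mu mphi).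
have nuE : mu A = nu A.
  apply: lebesgue_measure_unique => // _ [[a b] _ <-].
  rewrite /nu /= /mscale /= /pushforward /=.
  have -> : (fun t : R => t / r) @^-1` `]a, b] = `]a * r, b * r]%classic.
    apply/seteqP; split => t /=; rewrite !in_itv/= ltr_pdivlMr// ler_pdivrMr//.
  rewrite !lebesgue_measure_itv/= !lte_fin ltr_pM2r//.
  case: ifP => _; last by rewrite mule0.
  by rewrite -!EFinB -EFinM -mulrBl mulrC mulfK// gt_eqF.
by rewrite nuE /nu /= /mscale/= /pushforward muleA -EFinM divff ?gt_eqF// mul1e.
Qed.

Let ge0_integral_scale (r : R) (D : set (measurableTypeR R)) (f : R -> \bar R) :
  0 < r -> measurable D -> measurable_fun D f -> (forall t, (0 <= f t)%E) ->
  (\int[mu]_(t in (fun t : R => (t / r)%R) @^-1` D) f (t / r)%R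
   = r%:E * \int[mu]_(t in D) f t)%E.
Proof.
move=> r0 mD mf f0.
have mphi : measurable_fun [set: measurableTypeR R]
    ((fun t : R => t / r) : _ -> measurableTypeR R) by exact: mulrr_measurable.
rewrite -(ge0_integral_pushforward mphi)//.
rewrite -(ge0_integral_mscale mu mD (NngNum (ltW r0)))//.
apply: eq_measure_integral => A mA _.
exact: lebesgue_measure_scale.
Qed.

Lemma integral_scale (r a b : R) (f : R -> \bar R) : 0 < r ->
  mu.-integrable `[a / r, b / r] f ->
  (\int[mu]_(t in `[a, b]) f (t / r)%R =
   r%:E * \int[mu]_(t in `[(a / r)%R, (b / r)%R]) f t)%E.
Proof.
move=> r0 fi; have mf := measurable_int mu fi.
have -> : `[a, b]%classic = (fun t : R => t / r) @^-1` `[a / r, b / r].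
  apply/seteqP; split => t /=; rewrite !in_itv/= !ler_pM2r ?invr_gt0//.
(* Integrability makes the integral of the positive part finite, so [r] distributes over the
   difference. *)
rewrite integralE [in RHS]integralE muleBr//; last first.
  rewrite fin_num_adde_defr//; exact: integrable_pos_fin_num.
congr (_ - _)%E.
  rewrite -ge0_integral_scale//; last exact: measurable_funepos.
  by apply: eq_integral => t _; rewrite !funeposE.
rewrite -ge0_integral_scale//; last exact: measurable_funeneg.
by apply: eq_integral => t _; rewrite !funenegE.
Qed.

End lebesgue_scaling.

(** * Bochner integrals *)

Lemma cvg_dist_le {R : realType} (u e : R^nat) (l : R) :
  (forall n, `|l - u n| <= e n) -> e n @[n --> \oo] --> (0 : R) ->
  u n @[n --> \oo] --> l.
Proof.
move=> ue /cvgrPdist_le e0; apply/cvgrPdist_le => x x0.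
apply: filterS (e0 _ x0) => n; rewrite sub0r normrN => h.
by apply: le_trans (ue n) (le_trans (ler_norm _) h).
Qed.

Lemma bounded_integrable d {Y : measurableType d} {R : realType}
    (mu : {measure set Y -> \bar R}) (D : set Y) (f : Y -> R) (K : R) :
  measurable D -> (mu D < +oo)%E -> measurable_fun D f ->
  (forall s, D s -> `|f s| <= K) -> mu.-integrable D (EFin \o f).
Proof.
move=> mD fD mf fK; apply: measurable_bounded_integrable => //.
exists K; split; first exact: num_real.
by move=> x Kx s Ds; exact: le_trans (fK s Ds) (ltW Kx).
Qed.

Section strong_measurability.
Context {R : realType} {m : nat} (W : 'rV[R]_m -> 'M[R]_m).
Hypothesis mW : measurable_fun setT W.
Hypothesis gW : forall y, gram (W y).
Local Notation field := ('rV[R]_m -> 'M[R]_m).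
Local Notation mu := (@lebesgue_measure R).
Implicit Types (A X : field) (f : hsimple W) (F G : R -> field).

Lemma cvg_hdotl X (f : nat -> field) A : inH W X -> (forall n, inH W (f n)) ->
  inH W A -> hnorm W (X - f n) @[n --> \oo] --> (0 : R) ->
  hdot W (f n) A @[n --> \oo] --> hdot W X A.
Proof.
move=> hF hf hA cf.
apply: (@cvg_dist_le _ _ (fun n => hnorm W (X - f n) * hnorm W A)).
  move=> n; rewrite -hdotBl//; apply: hdot_norm => //; exact: inHB.
by rewrite -(mul0r (hnorm W A)); apply: cvgM => //; exact: cvg_cst.
Qed.

Lemma hs_fun_inH f s : inH W (hs_fun f s).
Proof. by apply: inH_sum => // k; apply: inHZ => //; exact: hs_inH. Qed.

Lemma hs_integral_inH D f : inH W (hs_integral D f).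
Proof. by apply: inH_sum => // k; apply: inHZ => //; exact: hs_inH. Qed.

Lemma hdot_hs_fun f s A : inH W A ->
  hdot W (hs_fun f s) A =
  \sum_k \1_(hs_set (h := f) k) s * hdot W (hs_val (h := f) k) A.
Proof.
move=> hA; rewrite hdot_suml//.
  by apply: eq_bigr => k _; rewrite hdotZl//; exact: hs_inH.
by move=> k; apply: inHZ => //; exact: hs_inH.
Qed.

Lemma hnorm_sum n (A : 'I_n -> field) : (forall k, inH W (A k)) ->
  hnorm W (\sum_k A k) <= \sum_k hnorm W (A k).
Proof.
move=> hA; suff : inH W (\sum_k A k) /\
  hnorm W (\sum_k A k) <= \sum_k hnorm W (A k) by case.
elim/big_ind2 : _ => [|A1 x1 A2 x2 [h1 e1] [h2 e2]|k _]; last by [].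
  by split; [exact: inH0|rewrite hnorm0].
split; first exact: inHD.
by apply: le_trans (hnormD mW gW h1 h2) _; exact: lerD.
Qed.

Lemma hnorm_hs_fun f : exists K, forall s, hnorm W (hs_fun f s) <= K.
Proof.
exists (\sum_k hnorm W (hs_val (h := f) k)) => s.
apply: le_trans (hnorm_sum _) _.
  by move=> k; apply: inHZ => //; exact: hs_inH.
apply: ler_sum => k _; rewrite hnormZ//; last exact: hs_inH.
rewrite ler_piMl ?hnorm_ge0// indicE ger0_norm//.
by case: (_ \in _).
Qed.

(** Convergence is asked at every [s], unlike in [ae_cvg], so that scalar products with [F] are
    everywhere limits of Borel functions. *)
Definition strong_approx F (f : nat -> hsimple W) :=
  (forall s, inH W (F s)) /\
  forall s, hnorm W (F s - hs_fun (f n) s) @[n --> \oo] --> (0 : R).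

Lemma strong_approx_hs f : strong_approx (hs_fun f) (fun=> f).
Proof.
split; first exact: hs_fun_inH.
by move=> s; rewrite subrr hnorm0//; exact: cvg_cst.
Qed.

Let measurable_hdot_hs f G : (forall s, inH W (G s)) ->
  (forall A, inH W A -> measurable_fun setT (fun s => hdot W A (G s))) ->
  measurable_fun setT (fun s => hdot W (hs_fun f s) (G s)).
Proof.
move=> hG mG.
rewrite (_ : (fun _ => _) = fun s => \sum_k
    \1_(hs_set (h := f) k) s * hdot W (hs_val (h := f) k) (G s)); last first.
  by apply/funext => s; rewrite hdot_hs_fun.
apply: measurable_sum => k; apply: measurable_funM; last by apply: mG; exact: hs_inH.
by apply: measurable_indic; exact: hs_measurable.
Qed.

Lemma measurable_hdot_cst F (f : nat -> hsimple W) A :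
  strong_approx F f -> inH W A ->
  measurable_fun setT (fun s => hdot W (F s) A).
Proof.
move=> [hF fF] hA.
apply: (@measurable_fun_cvg _ _ _ setT (fun n s => hdot W (hs_fun (f n) s) A)).
  move=> n; apply: measurable_hdot_hs => // B hB; exact: measurable_cst.
by move=> s _; apply: cvg_hdotl => // n; exact: hs_fun_inH.
Qed.

Lemma measurable_hdot F G (f g : nat -> hsimple W) :
  strong_approx F f -> strong_approx G g ->
  measurable_fun setT (fun s => hdot W (F s) (G s)).
Proof.
move=> [hF fF] gG; have [hG _] := gG.
apply: (@measurable_fun_cvg _ _ _ setT (fun n s => hdot W (hs_fun (f n) s) (G s))).
  move=> n; apply: measurable_hdot_hs => // B hB.
  under eq_fun do rewrite hdotC//.
  exact: measurable_hdot_cst gG hB.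
by move=> s _; apply: cvg_hdotl => // n; exact: hs_fun_inH.
Qed.

(** Expanding the square reduces the claim to scalar products. *)
Lemma measurable_hnormB F G (f g : nat -> hsimple W) :
  strong_approx F f -> strong_approx G g ->
  measurable_fun setT (fun s => hnorm W (F s - G s)).
Proof.
move=> fF gG; have [hF _] := fF; have [hG _] := gG.
rewrite (_ : (fun _ => _) = fun s => Num.sqrt (hdot W (F s) (F s)
   - 2 * hdot W (F s) (G s) + hdot W (G s) (G s))); last first.
  apply/funext => s; congr Num.sqrt.
  have hB : inH W (F s - G s) by exact: inHB.
  rewrite hdotBl// ![hdot W _ (F s - G s)]hdotC// !hdotBl// (hdotC gW (G s) (F s)).
  by ring.
apply: measurableT_comp.
  exact: (continuous_measurable_fun (@sqrt_continuous R)).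
apply: measurable_funD; last exact: (measurable_hdot gG gG).
apply: measurable_funB; first exact: (measurable_hdot fF fF).
by apply: measurable_funM; [exact: measurable_cst|exact: (measurable_hdot fF gG)].
Qed.

Lemma measurable_hnorm_hs f : measurable_fun setT (fun s => hnorm W (hs_fun f s)).
Proof.
apply: measurableT_comp.
  exact: (continuous_measurable_fun (@sqrt_continuous R)).
exact: (measurable_hdot (strong_approx_hs f) (strong_approx_hs f)).
Qed.

Section finite_domain.
Variable D : set (measurableTypeR R).
Hypotheses (mD : measurable D) (fD : (mu D < +oo)%E).

Lemma hdot_hs_integral f A : inH W A ->
  hdot W (hs_integral D f) A = \int[mu]_(s in D) hdot W (hs_fun f s) A.
Proof.
move=> hA; rewrite hdot_suml//; last first.
  by move=> k; apply: inHZ => //; exact: hs_inH.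
have ik k : mu.-integrable D (fun s => (\1_(hs_set (h := f) k) s)%:E).
  apply: (@bounded_integrable _ _ _ _ _ _ 1) => //.
    by apply: measurable_indic; exact: hs_measurable.
  by move=> s _; rewrite ger0_norm// indicE; case: (_ \in _).
under eq_Rintegral do rewrite hdot_hs_fun//.
rewrite /Rintegral; under eq_integral do rewrite -sumEFin.
rewrite integral_sum//=; last first.
  move=> k; under eq_fun do rewrite mulrC EFinM.
  by apply: integrableZl => //; exact: ik.
rewrite (_ : (\sum_(_ < _) _)%E = (\sum_k fine (mu (D `&` hs_set (h := f) k)) *
  hdot W (hs_val (h := f) k) A)%:E); last first.
  rewrite -sumEFin; apply: eq_bigr => k _.
  under eq_integral do rewrite mulrC EFinM.
  have mk := @hs_measurable _ _ _ f k.
  have fk : mu (D `&` hs_set (h := f) k) \is a fin_num.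
    rewrite ge0_fin_numE ?measure_ge0//; apply: le_lt_trans fD.
    by apply: le_measure; rewrite ?inE//; exact: measurableI.
  by rewrite (integralZl mD (ik k)) integral_indic// muleC EFinM (fineK fk) setIC.
by rewrite /=; apply: eq_bigr => k _; rewrite hdotZl//; exact: hs_inH.
Qed.

Lemma integrable_hdot F (g : nat -> hsimple W) (M : R) A :
  strong_approx F g -> (forall s, hnorm W (F s) <= M) -> inH W A ->
  mu.-integrable D (EFin \o (fun s => hdot W (F s) A)).
Proof.
move=> gF FM hA.
apply: (@bounded_integrable _ _ _ _ _ _ (M * hnorm W A)) => //.
  apply: measurable_funTS; exact: measurable_hdot_cst gF hA.
move=> s _; apply: le_trans (hdot_norm mW gW (gF.1 s) hA) _.
by rewrite ler_wpM2r// hnorm_ge0.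
Qed.

Variables (F : R -> field) (g : nat -> hsimple W) (M : R).
Hypotheses (gF : strong_approx F g) (FM : forall s, hnorm W (F s) <= M).

Lemma integrable_hnormB f :
  mu.-integrable D (EFin \o (fun s => hnorm W (F s - hs_fun f s))).
Proof.
have [K fK] := hnorm_hs_fun f.
apply: (@bounded_integrable _ _ _ _ _ _ (M + K)) => //.
  apply: measurable_funTS; exact: measurable_hnormB gF (strong_approx_hs f).
move=> s _; rewrite ger0_norm ?hnorm_ge0//.
apply: le_trans (hnorm_triangle mW gW (gF.1 s) (hs_fun_inH f s) (inH0 gW)) _.
rewrite subr0 sub0r hnormN// lerD//.
Qed.

(** The tested form of the basic estimate for Bochner integrals. It serves both to identify the
    limit and to show that the approximations are Cauchy. *)
Lemma hdot_hs_integral_dist f A : inH W A ->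
  `|hdot W (hs_integral D f) A - \int[mu]_(s in D) hdot W (F s) A| <=
  (\int[mu]_(s in D) hnorm W (F s - hs_fun f s)) * hnorm W A.
Proof.
move=> hA; have [K fK] := hnorm_hs_fun f.
have fi := integrable_hdot (strong_approx_hs f) fK hA.
have Fi := integrable_hdot gF FM hA.
have ni := integrable_hnormB f.
have di : mu.-integrable D
    (EFin \o (fun s => hdot W (hs_fun f s) A - hdot W (F s) A)).
  rewrite (_ : _ \o _ = (EFin \o (fun s => hdot W (hs_fun f s) A)) \-
    (EFin \o (fun s => hdot W (F s) A)))%E//; exact: integrableB.
rewrite hdot_hs_integral// -RintegralB//.
apply: le_trans (le_normr_Rintegral mD di) _.
rewrite -RintegralZr//; apply: le_Rintegral => //.
- exact: integrable_norm.
- pose nf s := hnorm W (F s - hs_fun f s).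
  rewrite (_ : _ \o _ = (EFin \o nf) \* cst (hnorm W A)%:E)%E//.
  exact: integrableZr.
- move=> s _; rewrite -hdotBl//; [|exact: hs_fun_inH|exact: gF.1].
  rewrite hnorm_distC//; apply: hdot_norm => //.
  by apply: inHB => //; [exact: hs_fun_inH|exact: gF.1].
Qed.

End finite_domain.

End strong_measurability.

Lemma distl_sub_le {R : realDomainType} (x y c p q : R) :
  `|x - c| <= p -> `|y - c| <= q -> x - y <= p + q.
Proof. by rewrite !ler_norml => /andP[_ ?] /andP[? _]; lra. Qed.

Lemma near_cvgn0 {R : realType} (u : R^nat) : u n @[n --> \oo] --> (0 : R) ->
  forall e, 0 < e -> exists N, forall n, (N <= n)%N -> `|u n| <= e.
Proof.
move=> /cvgrPdist_le u0 e /u0[N _ uN]; exists N => n /uN.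
by rewrite sub0r normrN.
Qed.

Lemma cvgn0_near {R : realType} (u : R^nat) :
  (forall e, 0 < e -> exists N, forall n, (N <= n)%N -> `|u n| <= e) ->
  u n @[n --> \oo] --> (0 : R).
Proof.
move=> u0; apply/cvgrPdist_le => e /u0[N uN]; exists N => // n Nn.
by rewrite sub0r normrN uN.
Qed.

Section bochner_integral.
Context {R : realType} {m : nat} (W : 'rV[R]_m -> 'M[R]_m).
Hypothesis mW : measurable_fun setT W.
Hypothesis gW : forall y, gram (W y).
Hypothesis uW : forall y, W y \in unitmx.
Local Notation field := ('rV[R]_m -> 'M[R]_m).
Local Notation mu := (@lebesgue_measure R).
Implicit Types (A X : field) (C F : R -> field).

Section restriction.
Variables (f : hsimple W) (E : set (measurableTypeR R)) (mE : measurable E).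

Let measurable_restr k :
  measurable (hs_set (h := f) k `&` E : set (measurableTypeR R)).
Proof. by apply: measurableI => //; exact: hs_measurable. Qed.

Let finite_restr k : (mu (hs_set (h := f) k `&` E) < +oo)%E.
Proof.
apply: le_lt_trans (hs_finite (h := f) k).
apply: le_measure; rewrite ?inE; [exact: measurable_restr|exact: hs_measurable|].
exact: subIsetl.
Qed.

Definition hs_restrict : hsimple W :=
  HSimple measurable_restr finite_restr (hs_inH (h := f)).

Lemma hs_fun_restrict s :
  hs_fun hs_restrict s = if s \in E then hs_fun f s else 0.
Proof.
rewrite /hs_fun /=; case: ifPn => sE.
  by apply: eq_bigr => k _; rewrite !indicE in_setI sE andbT.
by rewrite big1// => k _; rewrite indicE in_setI (negbTE sE) andbF scale0r.
Qed.

End restriction.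

(* [C] itself need not be Borel measurable in any sense, as almost everywhere
   convergence says nothing on a null set; [F] is a version of [C] that is a
   limit of simple functions everywhere. *)
Lemma Linfty_H_approx C : Linfty_H W C -> exists N F (g : nat -> hsimple W) M,
  [/\ measurable (N : set (measurableTypeR R)) /\ mu N = 0%E,
      forall s, ~ N s -> F s = C s, strong_approx F g,
      forall s, hnorm W (F s) <= M & forall n s, hnorm W (hs_fun (g n) s) <= M + 1].
Proof.
move=> [hC [f [N1 [mN1 N10 fC]]] [M0 [N2 [mN2 N20 CM]]]].
pose N := N1 `|` N2; pose M := Num.max M0 0.
have mN : measurable N by exact: measurableU.
have N0 : mu N = 0%E by apply: null_set_setU.
pose F s : field := if s \in N then 0 else C s.
(* Truncation provides the uniform bound for dominated convergence. Off [N], the simple functions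
   end up within 1 of a field of norm at most [M], so the truncation is eventually inactive; on [N]
   they vanish, as [F] does. *)
pose E n := [set s | hnorm W (hs_fun (f n) s) <= M + 1] `\` N.
have mE n : measurable (E n : set (measurableTypeR R)).
  apply: measurableD => //.
  rewrite (_ : [set s | _] =
      setT `&` (fun s => hnorm W (hs_fun (f n) s)) @^-1` `]-oo, (M + 1)]).
    by apply: measurable_hnorm_hs => //; exact: measurable_itv.
  by apply/seteqP; split=> s /=; rewrite in_itv/=; [split|case].
have M_ge0 : 0 <= M by rewrite le_max lexx orbT.
have NF s : ~ N s -> [/\ F s = C s, hnorm W (C s) <= M &
    hnorm W (C s - hs_fun (f n) s) @[n --> \oo] --> (0 : R)].
  move=> Ns; split.
  - by rewrite /F memNset.
  - rewrite le_max; apply/orP; left; apply: contra_notP Ns => Ns.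
    by right; apply: CM.
  - by apply: contra_notP Ns => Ns; left; apply: fC => /(_ I).
have hF s : inH W (F s) by rewrite /F; case: ifP => // _; exact: inH0.
exists N, F, (fun n => hs_restrict (f n) (mE n)), M; split => //.
- by move=> s /NF[].
- split=> // s; apply: cvgn0_near => e e0.
  have [sN|/negP] := boolP (s \in N).
    exists 0%N => n _; rewrite hs_fun_restrict /F sN memNset ?subrr; last first.
      by case=> _; apply; exact: set_mem.
    by rewrite hnorm0// normr0 ltW.
  rewrite inE => sN; have [FC CMs fs] := NF _ sN.
  have [n1 fe] := near_cvgn0 fs e0; have [n2 f1] := near_cvgn0 fs ltr01.
  exists (maxn n1 n2) => n; rewrite geq_max => /andP[/fe {}fe /f1 {}f1].
  have Es : E n s.
    split => //=; have := hnorm_le_dist mW gW (hs_fun_inH mW gW (f n) s) (hC s).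
    move: f1; rewrite ger0_norm ?hnorm_ge0// hnorm_distC// => f1.
    by move=> /(le_trans (ler_norm _)); lra.
  by rewrite hs_fun_restrict (mem_set Es) FC.
- move=> s; rewrite /F; case: ifPn => [_|]; first by rewrite hnorm0.
  by rewrite notin_setE => /NF[].
- move=> n s; rewrite hs_fun_restrict; case: ifPn => [|_].
    by rewrite inE => -[].
  by rewrite hnorm0// addr_ge0.
Qed.

Section bochner_hdot.
Variables (D : set (measurableTypeR R)) (C F : R -> field).
Variables (N : set (measurableTypeR R)) (g : nat -> hsimple W) (M : R).
Hypotheses (mD : measurable D) (fD : (mu D < +oo)%E).
Hypotheses (mN : measurable N) (N0 : mu N = 0%E).
Hypothesis FC : forall s, ~ N s -> F s = C s.
Hypotheses (gF : strong_approx F g) (FM : forall s, hnorm W (F s) <= M).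

Let integral_dist (f : hsimple W) :
  (\int[mu]_(s in D) (hnorm W (C s - hs_fun f s))%:E =
   (\int[mu]_(s in D) hnorm W (F s - hs_fun f s))%:E)%E.
Proof.
rewrite /Rintegral fineK; last first.
  by apply: integrable_fin_num => //; exact: integrable_hnormB gF FM f.
by apply: (eq_integral_null mN N0) => s /FC ->.
Qed.

(** Both sides are limits of the same tested simple integrals. The sequence is the one attached to
    [X], so the formula holds for whichever integral [xget] selects. *)
Lemma is_bochner_integral_hdot X A : is_bochner_integral W D C X -> inH W A ->
  hdot W X A = \int[mu]_(s in D) hdot W (F s) A.
Proof.
move=> [hX [f [_ fC fX]]] hA.
have c1 : hdot W (hs_integral D (f n)) A @[n --> \oo] --> hdot W X A.
  by apply: cvg_hdotl => // n; exact: hs_integral_inH.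
suff c2 : hdot W (hs_integral D (f n)) A @[n --> \oo] -->
    (\int[mu]_(s in D) hdot W (F s) A).
  exact: (cvg_unique _ c1 c2).
apply: (@cvg_dist_le _ _ (fun n =>
    (\int[mu]_(s in D) hnorm W (F s - hs_fun (f n) s)) * hnorm W A)).
  by move=> n; rewrite distrC; exact: hdot_hs_integral_dist gF FM _ _ hA.
rewrite -(mul0r (hnorm W A)); apply: cvgM; last exact: cvg_cst.
by move: fC; under eq_fun do rewrite integral_dist; move=> /fine_cvgP[].
Qed.

Hypothesis gM : forall n s, hnorm W (hs_fun (g n) s) <= M + 1.

Let cvg_integral_dist :
  \int[mu]_(s in D) hnorm W (F s - hs_fun (g n) s) @[n --> \oo] --> (0 : R).
Proof.
have mg n : measurable_fun D (fun s => (hnorm W (F s - hs_fun (g n) s))%:E).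
  apply/measurable_EFinP; apply: measurable_funTS.
  exact: (measurable_hnormB mW gW gF (strong_approx_hs mW gW (g n))).
have [||||_ _] := @dominated_convergence _ _ _ mu D mD
  (fun n s => (hnorm W (F s - hs_fun (g n) s))%:E) (cst 0%E)
  (cst (M + (M + 1))%:E) mg.
- exact: measurable_cst.
- apply: aeW => s _; apply: cvg_EFin; first exact: nearW.
  exact: gF.2.
- exact: (@bounded_integrable _ _ _ mu D (cst (M + (M + 1))) `|M + (M + 1)|).
- apply: aeW => s n _ /=; rewrite lee_fin ger0_norm ?hnorm_ge0//.
  have hs := hs_fun_inH mW gW (g n) s.
  apply: le_trans (hnorm_triangle mW gW (gF.1 s) hs (inH0 gW)) _.
  by rewrite subr0 sub0r hnormN lerD.
rewrite integral0 => /fine_cvgP[_]; apply.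
Qed.

(** The integrals of the [g n] are Cauchy because the L^1 distances to [F] tend to 0; completeness
    supplies the limit. *)
Lemma is_bochner_integral_exists : exists X, is_bochner_integral W D C X.
Proof.
pose r n := \int[mu]_(s in D) hnorm W (F s - hs_fun (g n) s).
have hI n : inH W (hs_integral D (g n)) by exact: hs_integral_inH.
(* Test [Z] against itself: only scalar integrals have to be estimated. *)
have dist k l : hnorm W (hs_integral D (g k) - hs_integral D (g l)) <= r k + r l.
  set Z := _ - _; have hZ : inH W Z by exact: inHB.
  have [->|Z0] := eqVneq (hnorm W Z) 0.
    by apply: addr_ge0; apply: Rintegral_ge0 => s _; exact: hnorm_ge0.
  have Zgt0 : 0 < hnorm W Z by rewrite lt_neqAle eq_sym Z0 hnorm_ge0.
  rewrite -(ler_pM2r Zgt0) -expr2 sqr_hnorm// {1}/Z hdotBl// mulrDl.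
  exact: (distl_sub_le (hdot_hs_integral_dist mW gW mD fD gF FM (g k) hZ)
                       (hdot_hs_integral_dist mW gW mD fD gF FM (g l) hZ)).
have [e e0|X hX cX] := inH_complete mW gW uW hI.
  have e20 : 0 < e / 2 by rewrite divr_gt0.
  have [n ne] := near_cvgn0 cvg_integral_dist e20.
  have {}ne k : (n <= k)%N -> r k <= e / 2.
    by move=> /ne; exact: le_trans (ler_norm _).
  exists n => k l nk nl; apply: le_trans (dist k l) _.
  by rewrite (splitr e) lerD// ne.
exists X; split => //; exists g; split => //.
- exists N; split => // s; apply: contra_notP => sN Ds.
  have := gF.2 s; rewrite (FC sN); exact.
- under eq_fun do rewrite integral_dist.
  by apply: cvg_EFin; [exact: nearW|exact: cvg_integral_dist].
Qed.

(** Existence guarantees that [xget] returns an actual integral rather than its default value. *)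
Lemma bochner_inH : inH W (bochner W D C).
Proof. by have [] := xgetPex 0 is_bochner_integral_exists. Qed.

Lemma hdot_bochner A : inH W A ->
  hdot W (bochner W D C) A = \int[mu]_(s in D) hdot W (F s) A.
Proof.
exact: is_bochner_integral_hdot (xgetPex 0 is_bochner_integral_exists).
Qed.

End bochner_hdot.

End bochner_integral.

(** * Averaging *)

Lemma cvg_within_dist {R : realType} (D : set R) (f d : R -> R) (t c : R) :
  d s @[s --> within D (nbhs t)] --> (0 : R) ->
  (forall s, D s -> `|f t - f s| <= d s * c) ->
  f s @[s --> within D (nbhs t)] --> f t.
Proof.
move=> /cvgrPdist_le d0 fd; apply/cvgrPdist_le => e e0.
have c0 : 0 < `|c| + 1 by rewrite ltr_wpDl.
have := d0 _ (divr_gt0 e0 c0); rewrite !near_withinE.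
apply: filterS => s h Ds; apply: le_trans (fd s Ds) _.
have {}h := h Ds; rewrite sub0r normrN ler_pdivlMr// in h.
apply: le_trans h; apply: le_trans (ler_norm _) _; rewrite normrM.
by rewrite ler_wpM2l// lerDl.
Qed.

Section time_average.
Context {R : realType} {m : nat} (W : 'rV[R]_m -> 'M[R]_m).
Hypothesis mW : measurable_fun setT W.
Hypothesis gW : forall y, gram (W y).
Hypothesis uW : forall y, W y \in unitmx.
Local Notation field := ('rV[R]_m -> 'M[R]_m).
Local Notation mu := (@lebesgue_measure R).

Variables (T : R) (B : R -> field).
Hypothesis hB : forall t, `[0, T]%classic t -> inH W (B t).
Hypothesis cB : forall t, `[0, T]%classic t ->
  hnorm W (B s - B t) @[s --> within `[0, T]%classic (nbhs t)] --> (0 : R).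

Lemma measurable_hdot_continuous A : inH W A ->
  measurable_fun `[0, T] (fun t => hdot W (B t) A).
Proof.
move=> hA; apply: subspace_continuous_measurable_fun; first exact: measurable_itv.
apply/subspace_continuousP => t tT.
apply: (cvg_within_dist (cB tT) (c := hnorm W A)) => s sT.
have [hs ht] := (hB sT, hB tT); rewrite -hdotBl// hnorm_distC//.
by apply: hdot_norm => //; exact: inHB.
Qed.

Variables (F : R -> field) (g : nat -> hsimple W) (M : R).
Hypotheses (gF : strong_approx F g) (FM : forall s, hnorm W (F s) <= M).

(** With a simple function in place of [F], the product is a finite sum of indicators of dilated
    sets times continuous functions of [t]; then pass to the limit. *)
Lemma measurable_hdot_scaled (r : R) :
  measurable_fun `[0, T] (fun t => hdot W (F (t / r)) (B t)).
Proof.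
apply: (@measurable_fun_cvg _ _ R `[0, T]%classic
  (fun n (t : R) => hdot W (hs_fun (g n) (t / r)) (B t))); last first.
  move=> t tT; apply: cvg_hdotl => //.
  - exact: gF.1.
  - by move=> n; exact: hs_fun_inH.
  - exact: hB.
  - exact: gF.2.
move=> n; pose f (t : R) : R := \sum_k
  \1_(hs_set (h := g n) k) (t / r) * hdot W (B t) (hs_val (h := g n) k).
apply: (@eq_measurable_fun _ _ _ _ `[0, T]%classic f).
  move=> t /set_mem tT; rewrite hdot_hs_fun//; last exact: hB.
  by apply: eq_bigr => k _; rewrite [in RHS]hdotC.
apply: measurable_sum => k; apply: measurable_funM; last first.
  by apply: measurable_hdot_continuous; exact: hs_inH.
apply: measurable_funTS.
have mi : measurable_fun setT (\1_(hs_set (h := g n) k) : R -> R).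
  by apply: measurable_indic; exact: hs_measurable.
exact: (measurableT_comp mi (@mulrr_measurable R setT r^-1)).
Qed.

Variables (N : set (measurableTypeR R)) (C : R -> field) (X : field).
Hypotheses (mN : measurable N) (N0 : mu N = 0%E).
Hypothesis FC : forall s, ~ N s -> F s = C s.
Hypothesis gM : forall n s, hnorm W (hs_fun (g n) s) <= M + 1.
Hypothesis hX : inH W X.

(** The dilation s = t / r produces a factor r = h (h / r)^-1, which turns the Bochner integral into
    [h] times a mean. *)
Lemma integral_hdot_scaled (t0 h r : R) A : 0 < h -> 0 < r -> inH W A ->
  \int[mu]_(t in `[t0, t0 + h]) hdot W (F (t / r)) A =
  h * hdot W ((h / r)^-1 *: bochner W `[t0 / r, t0 / r + h / r] C) A.
Proof.
move=> h0 r0 hA.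
pose D : set (measurableTypeR R) := `[t0 / r, t0 / r + h / r]%classic.
have mD : measurable D by exact: measurable_itv.
have fD : (mu D < +oo)%E.
  by rewrite lebesgue_measure_itv/=; case: ifP => _; rewrite -?EFinB ltry.
have hb := bochner_inH mW gW uW mD fD mN N0 FC gF FM gM.
rewrite hdotZl// (hdot_bochner mW gW uW mD fD mN N0 FC gF FM gM hA).
have iF := integrable_hdot mW gW mD fD gF FM hA.
have sc := @integral_scale _ r t0 (t0 + h) (fun s => (hdot W (F s) A)%:E) r0.
rewrite mulrDl in sc; rewrite /Rintegral (sc iF).
rewrite fineM//; last exact: integrable_fin_num.
by rewrite mulrA invf_div mulrCA divff ?mulr1// gt_eqF.
Qed.

Variables (K : R).
Hypothesis BK : forall t, `[0, T]%classic t -> hnorm W (B t) <= K.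
Hypothesis K0 : 0 <= K.

Let u r t := hdot W (F (t / r)) (B t) - hdot W X (B t).

Let finite_itv (a b : R) : (mu `[a, b] < +oo)%E.
Proof.
by rewrite lebesgue_measure_itv/=; case: ifP => _; rewrite -?EFinB ltry.
Qed.

Let sub_itv (a b t : R) : 0 <= a -> b <= T -> t \in `[a, b] -> `[0, T]%classic t.
Proof.
move=> a0 bT; rewrite /= !in_itv/= => /andP[at_ tb].
by rewrite (le_trans a0 at_) (le_trans tb bT).
Qed.

Lemma integrable_average r (a b : R) : 0 <= a -> b <= T ->
  mu.-integrable `[a, b] (EFin \o u r).
Proof.
move=> a0 bT; have mab : measurable (`[a, b]%classic : set (measurableTypeR R)).
  exact: measurable_itv.
have sab : `[a, b]%classic `<=` `[0, T]%classic by move=> t; exact: sub_itv.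
have mT : measurable (`[0, T]%classic : set (measurableTypeR R)).
  exact: measurable_itv.
apply: (@bounded_integrable _ _ _ _ _ _ (M * K + hnorm W X * K)) => //.
- exact: finite_itv.
- apply: (measurable_funS mT sab); apply: measurable_funB.
    exact: measurable_hdot_scaled.
  apply: (eq_measurable_fun (fun t => hdot W (B t) X)).
    by move=> t _; rewrite hdotC.
  exact: measurable_hdot_continuous.
- move=> t /sab tT; have hBt := hB tT.
  apply: le_trans (ler_normB _ _) _; apply: lerD.
    apply: le_trans (hdot_norm mW gW (gF.1 _) hBt) _.
    apply: ler_pM; [exact: hnorm_ge0|exact: hnorm_ge0|exact: FM|exact: BK].
  apply: le_trans (hdot_norm mW gW hX hBt) _.
  apply: ler_wpM2l; [exact: hnorm_ge0|exact: BK].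
Qed.

Lemma integral_average_step (t0 h r w de : R) :
  0 < h -> 0 < r -> 0 <= t0 -> t0 + h <= T ->
  (forall t, t \in `[t0, t0 + h] -> hnorm W (B t - B t0) <= w) ->
  hnorm W ((h / r)^-1 *: bochner W `[t0 / r, t0 / r + h / r] C - X) <= de ->
  `|\int[mu]_(t in `[t0, t0 + h]) u r t| <= h * (w * (M + hnorm W X) + K * de).
Proof.
move=> h0 r0 t00 t0T Bw Xde.
have t0in : t0 \in `[t0, t0 + h] by rewrite in_itv/= lexx lerDl ltW.
have hA := hB (sub_itv t00 t0T t0in); set A := B t0 in hA *.
(* The integrand with [B] frozen at [t0]. Its integral is [h] times the error of a mean, tested
   against [A], while [u r t - v t] is the product of [B t - A] with [F (t / r) - X]. *)
pose v t := hdot W (F (t / r)) A - hdot W X A.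
have mI : measurable (`[t0, t0 + h]%classic : set (measurableTypeR R)).
  exact: measurable_itv.
have iu := integrable_average r t00 t0T.
have fA : mu.-integrable `[t0, t0 + h] (EFin \o (fun t => hdot W (F (t / r)) A)).
  apply: (@bounded_integrable _ _ _ _ _ _ (M * hnorm W A)) => //.
  - exact: finite_itv.
  - apply: measurable_funTS.
    exact: (measurableT_comp (measurable_hdot_cst mW gW gF hA)
                             (@mulrr_measurable R setT r^-1)).
  - move=> t _; apply: le_trans (hdot_norm mW gW (gF.1 _) hA) _.
    by apply: ler_wpM2r; [exact: hnorm_ge0|exact: FM].
have cA : mu.-integrable `[t0, t0 + h] (EFin \o cst (hdot W X A)).
  apply: (@bounded_integrable _ _ _ _ _ _ `|hdot W X A|) => //; exact: finite_itv.
have iv : mu.-integrable `[t0, t0 + h] (EFin \o v).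
  rewrite (_ : _ \o _ = (EFin \o (fun t => hdot W (F (t / r)) A)) \-
    (EFin \o cst (hdot W X A)))%E//; exact: integrableB.
have itvh : fine (mu `[t0, t0 + h]) = h.
  by rewrite lebesgue_measure_itv/= lte_fin ltrDl h0 -EFinB/= addrAC subrr add0r.
have intv : `|\int[mu]_(t in `[t0, t0 + h]) v t| <= h * (K * de).
  rewrite RintegralB// integral_hdot_scaled// Rintegral_cst// itvh.
  rewrite (mulrC (hdot W X A)) -mulrBr normrM (ger0_norm (ltW h0)) ler_pM2l//.
  have hb : inH W ((h / r)^-1 *: bochner W `[t0 / r, t0 / r + h / r] C).
    apply: inHZ => //; exact: (bochner_inH mW gW uW (measurable_itv _)
      (finite_itv _ _) mN N0 FC gF FM gM).
  rewrite -hdotBl//.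
  apply: le_trans (hdot_norm mW gW (inHB mW gW hb hX) hA) _.
  rewrite mulrC; apply: ler_pM; [exact: hnorm_ge0|exact: hnorm_ge0| |exact: Xde].
  by apply: BK; exact: sub_itv t0in.
have intuv : `|\int[mu]_(t in `[t0, t0 + h]) (u r t - v t)| <=
    h * (w * (M + hnorm W X)).
  have iuv : mu.-integrable `[t0, t0 + h] (EFin \o (fun t => u r t - v t)).
    rewrite (_ : _ \o _ = (EFin \o u r) \- (EFin \o v))%E//; exact: integrableB.
  apply: le_trans (le_normr_Rintegral mI iuv) _.
  have -> : h * (w * (M + hnorm W X)) =
      \int[mu]_(t in `[t0, t0 + h]) (w * (M + hnorm W X)).
    by rewrite (Rintegral_cst mu mI) itvh mulrC.
  apply: le_Rintegral => //.
  - exact: integrable_norm.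
  - apply: (@bounded_integrable _ _ _ _ _ _ `|w * (M + hnorm W X)|) => //.
    exact: finite_itv.
  - move=> t tI; have hBt := hB (sub_itv t00 t0T tI).
    have hD : inH W (B t - A) by exact: inHB.
    have hFX : inH W (F (t / r) - X) by apply: inHB => //; exact: gF.1.
    have -> : u r t - v t = hdot W (B t - A) (F (t / r) - X).
      rewrite (hdotBl mW gW hBt hA hFX) (hdotC gW (B t)) (hdotC gW A).
      by rewrite !hdotBl//; exact: gF.1.
    apply: le_trans (hdot_norm mW gW hD hFX) _.
    apply: ler_pM; [exact: hnorm_ge0|exact: hnorm_ge0|exact: Bw|].
    apply: le_trans (hnorm_triangle mW gW (gF.1 _) hX (inH0 gW)) _.
    by rewrite subr0 sub0r hnormN lerD2r; exact: FM.
have -> : \int[mu]_(t in `[t0, t0 + h]) u r t =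
    \int[mu]_(t in `[t0, t0 + h]) (u r t - v t) +
    \int[mu]_(t in `[t0, t0 + h]) v t.
  by rewrite RintegralB// subrK.
by apply: le_trans (ler_normD _ _) _; rewrite mulrDr lerD.
Qed.

Lemma integral_average_sum n (h r c : R) : 0 < h -> n%:R * h <= T ->
  (forall k, (k < n)%N ->
    `|\int[mu]_(t in `[k%:R * h, k%:R * h + h]) u r t| <= c) ->
  `|\int[mu]_(t in `[0, n%:R * h]) u r t| <= n%:R * c.
Proof.
move=> h0; elim: n => [|n IH] nT nc.
  by rewrite !mul0r set_itv1 Rintegral_set1 normr0.
have nhE : n.+1%:R * h = n%:R * h + h by rewrite -natr1 mulrDl mul1r.
have nh0 : 0 <= n%:R * h by rewrite mulr_ge0// ltW.
have nnh : n%:R * h <= n.+1%:R * h by rewrite nhE lerDl ltW.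
have i1 := integrable_average r (lexx 0) nT.
have i2 := integrable_average r nh0 nT.
have := @Rintegral_itvB _ (u r) (BLeft 0) (BRight (n.+1%:R * h)) (n%:R * h) i1.
rewrite !bnd_simp => /(_ nh0 nnh) /eqP; rewrite subr_eq => /eqP ->.
apply: le_trans (ler_normD _ _) _.
have -> : n.+1%:R * c = c + n%:R * c by rewrite -natr1 mulrDl mul1r addrC.
apply: lerD; last first.
  by apply: IH => [|k kn]; [exact: le_trans nnh nT|apply: nc; exact: ltnW].
(* The splitting leaves an interval open on the left; adding its endpoint does not change the
   integral. *)
rewrite Rintegral_itv_obnd_cbnd; first by rewrite nhE; exact: nc.
apply: integrableS i2 => //.
by apply: subset_itvr; rewrite bnd_simp.
Qed.

End time_average.

(** * From the L^1 bound to a pointwise bound *)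

Section sup_bound.
Context {R : realType}.
Local Notation mu := (@lebesgue_measure R).

(** The integral of [f] is at least (c - w) T. It is applied to f = |B|_P, with [c] the value at one
    time and [w] = omega(T) bounding the oscillation. *)
Lemma le_of_integral_le (T K c w : R) (f : R -> R) : 0 < T -> 0 <= w ->
  (forall t, 0 <= f t) -> (\int[mu]_(t in `[0%R, T]) (f t)%:E <= K%:E)%E ->
  (forall t, t \in `[0, T] -> c - w <= f t) -> c <= `|K| / T + w.
Proof.
move=> T0 w0 f0 fK cf; have [cw|wc] := leP c w.
  by apply: le_trans cw _; rewrite lerDr divr_ge0// ltW.
have cw0 : 0 <= c - w by rewrite subr_ge0 ltW.
rewrite -lerBlDr ler_pdivlMr//; apply: le_trans (ler_norm K).
rewrite -lee_fin; apply: le_trans fK.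
have -> : ((c - w) * T)%:E = (\int[mu]_(t in `[0%R, T]) (c - w)%:E)%E.
  rewrite integral_cst//= lebesgue_measure_itv/= lte_fin T0.
  by rewrite -EFinB subr0 -EFinM.
by apply: (@ge0_le_integral_null _ _ _ mu set0) => // t tT _; rewrite lee_fin cf.
Qed.

End sup_bound.

Theorem proposition5p1 (R : realType) (m : nat) (hm : (1 <= m)%N)
    (b : 'rV[R]_m -> 'rV[R]_m) (db : 'rV[R]_m -> 'M[R]_m)
    (hb : W1infty_loc b db)
    (hdiv : {ae lebesgue_rV, forall y, \tr (db y) = 0})
    (hgrowth : exists2 K : R, 0 < K & forall y, enorm (b y) <= K * (1 + enorm y))
    (P Q : 'rV[R]_m -> 'M[R]_m)
    (hspd : forall y, spd (P y))
    (hQ : forall y, Q y = invmx (P y))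
    (hP2 : L2_loc P) (hQ2 : L2_loc Q)
    (hPeq : transport_eq b db P)
    (T : R) (hT : 0 < T)
    (C : R -> 'rV[R]_m -> 'M[R]_m) (hC : Linfty_H Q C)
    (Cbar : 'rV[R]_m -> 'M[R]_m) (hCbar : inH Q Cbar)
    (hmean : forall e : R, 0 < e -> \forall S \near +oo, forall s0 : R,
      hnorm Q (S^-1 *: bochner Q `[s0, s0 + S] C - Cbar) < e)
    (omega : R -> R)
    (homega0 : forall l, l \in `[0, T] -> 0 <= omega l)
    (homega_nd : {in `[0, T] &, {homo omega : x y / x <= y}})
    (homega_lim : omega l @[l --> 0^'+] --> (0 : R))
    (Bset : set (R -> 'rV[R]_m -> 'M[R]_m))
    (hBcont : forall B, Bset B -> continuous_H P T B)
    (hBbnd : exists K : R, forall B, Bset B ->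
      (\int[lebesgue_measure]_(t in `[0%R, T]) (hnorm P (B t))%:E <= K%:E)%E)
    (hBmod : forall B, Bset B ->
      forall t t', t \in `[0, T] -> t' \in `[0, T] ->
        hnorm P (B t - B t') <= omega `|t - t'|) :
  forall e : R, 0 < e -> \forall eps \near 0^'+, forall B, Bset B ->
    `| \int[lebesgue_measure]_(t in `[0, T]) pairing (B t) (C (t / eps))
       - \int[lebesgue_measure]_(t in `[0, T]) pairing (B t) Cbar | < e.
Proof.
move=> e e0.
have mP := hP2.1; have mQ := hQ2.1.
have gQ y : gram (Q y) by rewrite hQ; exact: spd_gramV.
have uQ y : Q y \in unitmx by rewrite hQ unitmx_inv spd_unitmx.
have [N [F [g [M [[mN N0] FC gF FM gM]]]]] := Linfty_H_approx mQ gQ hC.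
have [K0 hK0] := hBbnd.
have wT0 : 0 <= omega T by apply: homega0; rewrite in_itv/= lexx ltW.
pose K := `|K0| / T + omega T.
have K_ge0 : 0 <= K by rewrite addr_ge0// divr_ge0// ltW.
have M_ge0 : 0 <= M by exact: le_trans (hnorm_ge0 Q (F 0)) (FM 0).
pose L := M + hnorm Q Cbar.
have L_ge0 : 0 <= L by rewrite addr_ge0// hnorm_ge0.
have BK B : Bset B -> forall t, t \in `[0, T] -> hnorm P (B t) <= K.
  move=> SB t tT; apply: (le_of_integral_le hT wT0 _ (hK0 B SB)) => [s|s sT].
    exact: hnorm_ge0.
  have [hs ht] := ((hBcont B SB).1 s sT, (hBcont B SB).1 t tT).
  have gP y : gram (P y) by have [A _ ->] := spd_cholesky (hspd y); exists A.
  have h1 := hnorm_le_dist mP gP ht hs.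
  have h2 := hBmod B SB t s tT sT.
  have h3 : omega `|t - s| <= omega T.
    move: (tT) (sT); rewrite !in_itv/= => /andP[? ?] /andP[? ?].
    have tsT : `|t - s| <= T by rewrite ler_norml; apply/andP; split; lra.
    by apply: homega_nd => //; rewrite in_itv/= ?normr_ge0 ?lexx ?tsT// ltW.
  rewrite lerBlDr -lerBlDl; apply: le_trans h3; apply: le_trans h2.
  exact: le_trans (ler_norm _) h1.
(* Each of the two errors, summed over [0, T], receives a quarter of [e]; [x] will be [L], then [K].
   The added 1 keeps the denominator positive when these vanish. *)
have quarter x : 0 <= x -> T * (e / (4 * T * (x + 1)) * x) <= e / 2 / 2.
  move=> x0; have x1 : 0 < x + 1 by rewrite ltr_wpDl.
  have -> : e / 2 / 2 = T * (e / (4 * T * (x + 1)) * (x + 1)).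
    by field; rewrite !gt_eqF.
  by rewrite ler_pM2l// ler_wpM2l ?lerDl// divr_ge0 ?mulr_ge0 ?ltW.
have a0 : 0 < e / (4 * T * (L + 1)).
  by rewrite divr_gt0// mulr_gt0 ?mulr_gt0// ltr_wpDl.
have d0 : 0 < e / (4 * T * (K + 1)).
  by rewrite divr_gt0// mulr_gt0 ?mulr_gt0// ltr_wpDl.
have /cvgrPdist_le/(_ _ a0)[eta /= eta0 omega_eta] := homega_lim.
(* Here 1 / (n + 1) < eta / T, so the step h = T / (n + 1) is below [eta]. *)
have [n] := ltr_add_invr (divr_gt0 eta0 hT); rewrite add0r => nT.
pose h := T / n.+1%:R.
have h0 : 0 < h by rewrite divr_gt0.
have hnT : n.+1%:R * h = T by rewrite mulrC divfK.
have omega_h : omega h <= e / (4 * T * (L + 1)).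
  have hh : `|0 - h| < eta.
    by rewrite sub0r normrN (gtr0_norm h0) /h mulrC -ltr_pdivlMr.
  by have := omega_eta h hh h0; rewrite sub0r normrN; exact: le_trans (ler_norm _).
have [S0 [_ hS0]] := hmean _ d0.
near=> eps => B SB.
have eps0 : 0 < eps by near: eps; exact: nbhs_right_gt.
(* Requiring eps < h / (|S0| + 1) covers a threshold [S0] of any sign. *)
have hS : S0 < h / eps.
  have S1 : 0 < `|S0| + 1 by rewrite ltr_wpDl.
  have : eps < h / (`|S0| + 1).
    by near: eps; apply: nbhs_right_lt; rewrite divr_gt0.
  rewrite ltr_pdivlMr// mulrC -ltr_pdivlMr//; apply: lt_trans.
  by apply: le_lt_trans (ler_norm _) _; rewrite ltrDl.
pose D t := dual_field P (B t).
have hD t : `[0, T]%classic t -> inH Q (D t).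
  by move=> tT; apply: inH_dual => //; exact: (hBcont B SB).1.
have DE s t : hnorm Q (D s - D t) = hnorm P (B s - B t).
  by rewrite -dual_fieldB (hnorm_dual hspd hQ).
have cD t : `[0, T]%classic t ->
    hnorm Q (D s - D t) @[s --> within `[0, T]%classic (nbhs t)] --> (0 : R).
  by move=> tT; under eq_fun do rewrite DE; exact: (hBcont B SB).2.
have DK t : `[0, T]%classic t -> hnorm Q (D t) <= K.
  by move=> tT; rewrite (hnorm_dual hspd hQ); exact: BK.
pose u t := hdot Q (F (t / eps)) (D t) - hdot Q Cbar (D t).
(* The times [t] with t / eps in [N] form a null set by scaling, so [F] may replace [C] under the
   integral. *)
have -> : \int[lebesgue_measure]_(t in `[0, T]) pairing (B t) (C (t / eps)) =
    \int[lebesgue_measure]_(t in `[0, T]) hdot Q (F (t / eps)) (D t).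
  have mphi := @mulrr_measurable R setT eps^-1.
  have mNe : measurable ((fun t : R => t / eps) @^-1` N :
      set (measurableTypeR R)).
    by rewrite -[X in measurable X]setTI; exact: mphi.
  have Ne0 : lebesgue_measure ((fun t : R => t / eps) @^-1` N) = 0%E.
    by rewrite lebesgue_measure_scale// N0 mule0.
  congr fine; apply: (eq_integral_null mNe Ne0) => t Nt.
  by rewrite (pairingE hspd hQ) hdotC// FC.
have -> : \int[lebesgue_measure]_(t in `[0, T]) pairing (B t) Cbar =
    \int[lebesgue_measure]_(t in `[0, T]) hdot Q Cbar (D t).
  by apply: eq_Rintegral => t _; rewrite (pairingE hspd hQ) hdotC.
have mT : measurable (`[0, T]%classic : set (measurableTypeR R)).
  exact: measurable_itv.
have iu := integrable_average mQ gQ hD cD gF FM hCbar DK eps (lexx 0) (lexx T).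
have fT : (lebesgue_measure (`[0%R, T]%classic : set (measurableTypeR R)) < +oo)%E.
  by rewrite lebesgue_measure_itv/=; case: ifP => _; rewrite -?EFinB ltry.
have ic : lebesgue_measure.-integrable `[0, T]
    (EFin \o (fun t => hdot Q Cbar (D t))).
  apply: (@bounded_integrable _ _ _ _ _ _ (hnorm Q Cbar * K)) => //.
  - apply: (eq_measurable_fun (fun t => hdot Q (D t) Cbar)).
      by move=> t _; rewrite hdotC.
    exact: measurable_hdot_continuous.
  - move=> t tT; apply: le_trans (hdot_norm mQ gQ hCbar (hD _ tT)) _.
    by apply: ler_wpM2l; [exact: hnorm_ge0|exact: DK].
have -> : \int[lebesgue_measure]_(t in `[0, T]) hdot Q (F (t / eps)) (D t) =
    \int[lebesgue_measure]_(t in `[0, T]) u t +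
    \int[lebesgue_measure]_(t in `[0, T]) hdot Q Cbar (D t).
  by rewrite -RintegralD//; apply: eq_Rintegral => t _; rewrite /u subrK.
rewrite addrK.
have := @integral_average_sum _ _ _ mQ gQ _ _ hD cD _ _ _ gF FM _ hCbar _ DK
  n.+1 h eps (h * (omega h * L + K * (e / (4 * T * (K + 1))))) h0.
rewrite hnT => /(_ (lexx T)) step.
apply: (@le_lt_trans _ _ (e / 2)); last by rewrite ltr_pdivrMr// ltr_pMr// ltr1n.
apply: le_trans (step _) _.
  move=> k kn; have kh0 : 0 <= k%:R * h by rewrite mulr_ge0// ltW.
  have khT : k%:R * h + h <= T.
    by rewrite -hnT -[X in _ + X]mul1r -mulrDl ler_pM2r// natr1 ler_nat.
  apply: (integral_average_step mQ gQ uQ hD cD gF FM mN N0 FC gM hCbar DK) => //.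
    move=> t tI; rewrite DE.
    have tkh : `|t - k%:R * h| <= h.
      by move: tI; rewrite in_itv/= ler_norml => /andP[? ?]; apply/andP; split; lra.
    have hlT : h <= T by apply: le_trans khT; rewrite lerDr.
    have [t1 t2] : t \in `[0, T] /\ k%:R * h \in `[0, T].
      move: tI; rewrite !in_itv/= => /andP[? ?]; split; apply/andP; split; lra.
    apply: le_trans (hBmod B SB _ _ t1 t2) _; apply: homega_nd.
    - by rewrite in_itv/= normr_ge0 (le_trans tkh).
    - by rewrite in_itv/= hlT ltW.
    - exact: tkh.
  (* The mean over the window starting at k h / eps, of length h / eps > S0. *)
  by apply: ltW; exact: hS0.
rewrite mulrA hnT mulrDr (splitr (e / 2)); apply: lerD.
  apply: le_trans (quarter L L_ge0); rewrite ler_pM2l//.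
  exact: ler_wpM2r omega_h.
by rewrite (mulrC K); exact: quarter.
Unshelve. all: by end_near. Qed.
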